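(* Let $\Omega=(a,b)\subseteq\mathbb{R}$ be a bounded open interval, $\alpha\in C(\overline\Omega)$ with $\alpha\ge0$, and $f\in BV(\Omega)$. If $$u=\operatorname*{argmin}_{u\in BV(\Omega)}\ \frac12\int_\Omega (f-u)^2\,dx+\int_\Omega \alpha(x)\,d|Du|,$$ then $$|Du|(\Omega)\le|Df|(\Omega).$$
   Context: For $u\in BV(\Omega)$, $|Du|$ is the total variation measure of the distributional derivative $Du$, so $|Du|(\Omega)$ is the total variation of $u$. The weight $\alpha$ is allowed to vanish; the minimisation problem has a unique solution in $BV(\Omega)$. *)

(* Defs.v *)
From HB Require Import structures.
From mathcomp Require Import all_boot all_order all_algebra.
From mathcomp Require Import all_classical all_reals all_analysis.

Set Implicit Arguments.
Unset Strict Implicit.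
Unset Printing Implicit Defensive.

Import Order.TTheory GRing.Theory Num.Theory.
Import numFieldNormedType.Exports.

Local Open Scope ring_scope.
Local Open Scope classical_set_scope.

Section charge_integration.
Context d (T : measurableType d) (R : realType).
Implicit Type nu : {charge set T -> \bar R}.

(* A Hahn decomposition is unique only up to null sets, but the two parts of
   the Jordan decomposition below do not depend on the one that is chosen. *)
Definition hahn_pos_set nu : set T := projT1 (cid (Hahn_decomposition nu)).

Definition hahn_neg_set nu : set T :=
  projT1 (cid (projT2 (cid (Hahn_decomposition nu)))).

Definition hahn_setsP nu :
    hahn_decomposition nu (hahn_pos_set nu) (hahn_neg_set nu) :=
  projT2 (cid (projT2 (cid (Hahn_decomposition nu)))).

Definition pos_part nu : {measure set T -> \bar R} :=
  jordan_pos (hahn_setsP nu).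

Definition neg_part nu : {measure set T -> \bar R} :=
  jordan_neg (hahn_setsP nu).

(* [charge_variation] is only equipped with a charge structure; the measure
   structure is needed to integrate against |nu|. *)
Definition variation_measure nu : {measure set T -> \bar R} :=
  measure_add (pos_part nu) (neg_part nu).

Lemma variation_measureE nu A :
  variation_measure nu A = charge_variation (hahn_setsP nu) A.
Proof. exact: measure_addE. Qed.

Definition charge_integral nu (D : set T) (g : T -> R) : R :=
  \int[pos_part nu]_(x in D) g x - \int[neg_part nu]_(x in D) g x.

End charge_integration.

Section bounded_variation_functions.
Context (R : realType).
Implicit Types (a b : R) (u v f alpha phi : R -> R).

Local Notation leb := (@lebesgue_measure R).

(* phi belongs to C_c^oo(]a, b[), extended by 0 to the real line. *)
Definition test_function a b phi : Prop :=
  [/\ forall (n : nat) (x : R), derivable (phi^`(n)) x 1,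
      compact (closure [set x | phi x != 0]) &
      closure [set x | phi x != 0] `<=` `]a, b[ ].

(* Finite signed Borel measures on ]a, b[ are encoded as charges on the line
   that vanish outside ]a, b[. *)
Definition is_distr_derivative a b u
    (nu : {charge set (measurableTypeR R) -> \bar R}) : Prop :=
  (forall A : set (measurableTypeR R),
     measurable A -> A `&` `]a, b[ = set0 -> nu A = 0%E) /\
  (forall phi, test_function a b phi ->
     \int[leb]_(x in `]a, b[) (u x * (phi^`())%classic x) =
     - charge_integral nu `]a, b[ phi).

(* Elements of BV are represented by Borel functions on the line, of which
   only the restriction to ]a, b[ matters. *)
Definition BV a b u : Prop :=
  leb.-integrable `]a, b[ (EFin \o u) /\
  exists nu, is_distr_derivative a b u nu.

(* The measure Du of a function u in BV; the value [czero] is junk for the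
   functions that have no measure derivative. *)
Definition distr_derivative a b u :
    {charge set (measurableTypeR R) -> \bar R} :=
  if pselect (exists nu, is_distr_derivative a b u nu) is left h
  then projT1 (cid h) else czero.

Lemma distr_derivativeP a b u :
  BV a b u -> is_distr_derivative a b u (distr_derivative a b u).
Proof.
move=> [_ h]; rewrite /distr_derivative.
by case: pselect => // h'; exact: projT2 (cid h').
Qed.

Definition total_var_measure a b u :
    {measure set (measurableTypeR R) -> \bar R} :=
  variation_measure (distr_derivative a b u).

Definition weighted_TV_energy a b alpha f u : \bar R :=
  ((2^-1)%:E * \int[leb]_(x in `]a, b[) ((f x - u x) ^+ 2)%:E
   + \int[total_var_measure a b u]_(x in `]a, b[) (alpha x)%:E)%E.

Definition is_argmin_BV a b (E : (R -> R) -> \bar R) u : Prop :=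
  BV a b u /\ forall v, BV a b v -> (E u <= E v)%E.

End bounded_variation_functions.

(* Main.v *)
Require Import Defs.
From HB Require Import structures.
From mathcomp Require Import all_boot all_order all_algebra.
From mathcomp Require Import all_classical all_reals all_analysis.
From mathcomp Require Import measurable_realfun ring lra.

(* Write u and f as their right-continuous representatives, the primitives of Du
   and Df, and let v be the primitive of u - f that vanishes at b.  Comparing u
   with u + t (k - w), where Dw is the restriction of Du to a Borel set S, gives
   v(a) = 0 and \int_S v dDu >= 0: such a competitor does not increase the weighted
   variation, whatever the weight is.  Hence u is nondecreasing where v > 0 and
   nonincreasing where v < 0.  On an excursion ]l, r[ of v above 0, the values of u
   therefore increase; since v' = u - f, they start above f(l) and are caught up by
   f before r.  So u is monotone between two values that f takes in order, and with
   V(x) = |Df|(]a, x]) and l(x) the last zero of v before x, the function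
   Phi(x) = V(l(x)) + |u(x) - f(l(x))| satisfies |u(y) - u(x)| <= Phi(y) - Phi(x)
   and 0 <= Phi <= |Df|(]a, b[), which bounds |Du|. *)

Set Implicit Arguments.
Unset Strict Implicit.
Unset Printing Implicit Defensive.

Import Order.TTheory GRing.Theory Num.Theory.
Import numFieldNormedType.Exports.

Local Open Scope ring_scope.
Local Open Scope classical_set_scope.

(** * Jordan decomposition *)

(** The weight is arbitrary and may vanish, so its size can never be exploited: the usable
    competitors are those whose variation measure is dominated set by set by that of u. Damping Du
    by a factor 1 - t on a Borel set, with t in [0, 1], and adding a constant provides enough of
    them. Optimality then constrains the sign of Du where v has a sign, and says nothing of Du on
    the zero set of v. There u and f may both jump, so v(x) = 0 does not give u(x) = f(x); what
    survives is one-sided: if they differ, right continuity of u - f makes an excursion start at x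
    itself. In Phi, the term V(l(x)) is variation of f already spent, and |u(x) - f(l(x))| is a debt
    that f repays before the excursion ends. The equality v(a) = 0 provides a last zero before every
    x, and v(b) = 0, which holds by construction, ensures that the last debt is repaid too. *)

Section variation.
Context d (T : measurableType d) (R : realType).
Implicit Types (nu : {charge set T -> \bar R}) (A : set T).

Lemma measurable_hahn_pos_set nu : measurable (hahn_pos_set nu).
Proof. by case: (hahn_setsP nu) => -[]. Qed.

Lemma measurable_hahn_neg_set nu : measurable (hahn_neg_set nu).
Proof. by case: (hahn_setsP nu) => _ []. Qed.

Lemma pos_partE nu A : measurable A -> pos_part nu A = nu (A `&` hahn_pos_set nu).
Proof.
move=> mA; change (pos_part nu A) with (jordan_pos (hahn_setsP nu) A).
by rewrite jordan_posE cjordan_posE /crestr0 mem_set.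
Qed.

Lemma neg_partE nu A :
  measurable A -> neg_part nu A = (- nu (A `&` hahn_neg_set nu))%E.
Proof.
move=> mA; change (neg_part nu A) with (jordan_neg (hahn_setsP nu) A).
by rewrite jordan_negE cjordan_negE /crestr0 mem_set.
Qed.

Lemma charge_jordanE nu A : measurable A -> nu A = (pos_part nu A - neg_part nu A)%E.
Proof.
move=> mA; rewrite (jordan_decomp (hahn_setsP nu) mA) /cadd/=.
by rewrite cscaleN1.
Qed.

Lemma pos_part_fin nu A : measurable A -> pos_part nu A \is a fin_num.
Proof.
by move=> mA; rewrite pos_partE// fin_num_measure//; apply: measurableI => //;
  exact: measurable_hahn_pos_set.
Qed.

Lemma neg_part_fin nu A : measurable A -> neg_part nu A \is a fin_num.
Proof.
by move=> mA; rewrite neg_partE// fin_numN fin_num_measure//; apply: measurableI => //;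
  exact: measurable_hahn_neg_set.
Qed.

Lemma variation_jordanE nu A :
  variation_measure nu A = (pos_part nu A + neg_part nu A)%E.
Proof. exact: measure_addE. Qed.

Lemma variation_measure_fin nu A :
  measurable A -> variation_measure nu A \is a fin_num.
Proof.
by move=> mA; rewrite variation_jordanE fin_numD pos_part_fin ?neg_part_fin.
Qed.

Lemma le_abs_variation_measure nu A :
  measurable A -> (`|nu A| <= variation_measure nu A)%E.
Proof. by move=> mA; rewrite variation_measureE abse_charge_variation. Qed.

(** Minimality of the Jordan decomposition: [pos_part nu A] is the [nu]-mass of [A] within the Hahn
    positive set, and there [nu] is at most [m1]. The splitting is stated as a sum because [m1] and
    [m2] may take infinite values. *)
Lemma pos_part_le nu (m1 m2 : {measure set T -> \bar R}) :
    (forall A, measurable A -> nu A + m2 A = m1 A)%E ->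
  forall A, measurable A -> (pos_part nu A <= m1 A)%E.
Proof.
move=> num A mA; rewrite pos_partE//.
have mAP := measurableI _ _ mA (measurable_hahn_pos_set nu).
apply: (@le_trans _ _ (m1 (A `&` hahn_pos_set nu))); last first.
  by apply: le_measure; rewrite ?inE.
by rewrite -num// leeDl.
Qed.

Lemma neg_part_le nu (m1 m2 : {measure set T -> \bar R}) :
    (forall A, measurable A -> nu A + m2 A = m1 A)%E ->
  forall A, measurable A -> (neg_part nu A <= m2 A)%E.
Proof.
move=> num A mA; rewrite neg_partE//.
have mAN := measurableI _ _ mA (measurable_hahn_neg_set nu).
apply: (@le_trans _ _ (m2 (A `&` hahn_neg_set nu))); last first.
  by apply: le_measure; rewrite ?inE.
have : (0 <= m1 (A `&` hahn_neg_set nu))%E by [].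
rewrite -(num _ mAN); case: (m2 _) => [r||] //=; rewrite ?leey ?leeNy ?leNye//.
  have : nu (A `&` hahn_neg_set nu) \is a fin_num by exact: fin_num_measure.
  case: (nu _) => [s||] //= _.
  rewrite -EFinD !lee_fin; lra.
by rewrite addeNy leNgt ltNy0.
Qed.

(** The two main upper bounds come from exhibiting such a splitting: damped Jordan parts for the
    competitors, Stieltjes measures for the final estimate. *)
Lemma variation_measure_le nu (m1 m2 : {measure set T -> \bar R}) :
    (forall A, measurable A -> nu A + m2 A = m1 A)%E ->
  forall A, measurable A -> (variation_measure nu A <= m1 A + m2 A)%E.
Proof.
move=> num A mA; rewrite variation_jordanE.
by apply: leeD; [exact: pos_part_le num _ mA|exact: neg_part_le num _ mA].
Qed.

Lemma variation_measure_eq0 nu A : measurable A ->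
    (forall B, measurable B -> B `<=` A -> nu B = 0%E) ->
  variation_measure nu A = 0%E.
Proof.
move=> mA nu0; rewrite variation_jordanE pos_partE// neg_partE// !nu0 ?oppe0 ?adde0//.
- by apply: measurableI => //; exact: measurable_hahn_neg_set.
- by apply: measurableI => //; exact: measurable_hahn_pos_set.
Qed.

End variation.

(** * Fubini for primitives of measures *)

Section fubini_primitive.
Context (R : realType).
Local Notation leb := (@lebesgue_measure R).
Local Notation mR := (measurableTypeR R).

Lemma measurable_le_prod : measurable [set z : mR * mR | (z.2 <= z.1)%R].
Proof.
have := @measurable_fun_le _ (mR * mR)%type R setT (fun z => (z.2 : R))
  (fun z => (z.1 : R)) measurableT.
rewrite setTI; apply.
  exact: (@measurable_snd _ _ mR mR).
exact: (@measurable_fst _ _ mR mR).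
Qed.

(** Both sides integrate [h x] over the triangle [a < y <= x < b], in the two orders. Integrability
    on the product follows from Tonelli: the inner integral of the norm is at most the total mass of
    [m] times [|h x|]. *)
Let fubini_primitive_finite (a b : R) (h : R -> R)
    (m : {finite_measure set mR -> \bar R}) :
    leb.-integrable `]a, b[ (EFin \o h) ->
  \int[leb]_(x in `]a, b[) (h x * fine (m `]a, x]%classic)) =
  \int[m]_(y in `]a, b[) (\int[leb]_(x in `[y, b[) h x).
Proof.
move=> ih.
pose D : set mR := `]a, b[%classic.
pose L : set (mR * mR) := [set z : mR * mR | (z.2 <= z.1)%R].
pose f (z : mR * mR) : \bar R :=
  ((h \_ D) z.1 * (\1_D z.2 * \1_L z))%:E.
have mD : measurable D by exact: measurable_itv.
have ihD : leb.-integrable setT (EFin \o (h \_ D)).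
  move/integrable_mkcond : ih => /(_ mD).
  by rewrite restrict_EFin.
have mhD : measurable_fun [set: mR] (h \_ D).
  by apply/measurable_EFinP; exact: (measurable_int leb).
have mf : measurable_fun setT f.
  apply/measurable_EFinP/measurable_funM.
    apply: (measurableT_comp mhD); exact: measurable_fst.
  apply: measurable_funM; last exact: measurable_indic measurable_le_prod.
  by apply: (measurableT_comp (measurable_indic mD)); exact: measurable_snd.
have fE x y : f (x, y) = ((h \_ D) x * \1_(D `&` [set y | y <= x]) y)%:E.
  by rewrite /f/= indicI/=; congr (_ * (_ * _))%:E.
have mDx x : measurable (D `&` [set y | y <= x]).
  apply: measurableI => //.
  have -> : [set y | y <= x] = `]-oo, x]%classic by apply/seteqP; split => z /=; rewrite in_itv.
  exact: measurable_itv.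
have inner1 x : (\int[m]_y f (x, y) = ((h \_ D) x * fine (m (D `&` [set y | y <= x])))%:E)%E.
  under eq_integral do rewrite fE EFinM.
  rewrite integralZl//; last exact: integrable_indic.
  by rewrite integral_indic// setIT EFinM fineK// fin_num_measure.
have iF : (leb \x m)%E.-integrable setT f.
  apply/(integrable12ltyP _ _ mf).
  apply: (@le_lt_trans _ _ (\int[leb]_x ((fine (m setT))%:E * `|(h \_ D) x|%:E))%E).
    apply: ge0_le_integral => //.
    - by move=> x _; apply: integral_ge0.
    - apply: (measurable_fun_fubini_tonelli_F (m2 := m) (fun z => `|f z|%E)).
        exact: measurableT_comp.
      by [].
    - apply: emeasurable_funM; first exact: measurable_cst.
      by apply/measurable_EFinP; exact: measurableT_comp.
    - move=> x _.
      under eq_integral do rewrite fE abse_EFin normrM EFinM [X in (_ * X%:E)%E]ger0_norm//.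
      rewrite ge0_integralZl//; last first.
        by apply/measurable_EFinP; exact: measurable_indic.
      rewrite muleC; apply: lee_pmul => //; first exact: integral_ge0.
      rewrite fineK ?fin_num_measure//.
      by rewrite integral_indic// setIT le_measure ?inE.
  rewrite ge0_integralZl//; last first.
  - by rewrite lee_fin fine_ge0.
  - apply/measurable_EFinP; exact: measurableT_comp.
  have [_] := integrableP _ _ _ ihD.
  by move=> ?; rewrite lte_mul_pinfty// lee_fin fine_ge0.
have := Fubini iF.
under eq_integral do rewrite inner1.
move=> /(congr1 fine) E1.
rewrite /Rintegral integral_mkcond.
transitivity (fine (\int[leb]_x ((h \_ D) x * fine (m (D `&` [set y | y <= x])))%:E)%E).
  congr fine; apply: eq_integral => x _; rewrite restrict_EFin/= /patch.
  case: ifPn => [xD|]; last by rewrite mul0r.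
  congr (_ * fine (m _))%:E; apply/seteqP; split => z /=; rewrite /D/= !in_itv/=.
    move: xD; rewrite inE/= in_itv/= => /andP[_ xb] /andP[-> zx]; split => //=.
    exact: le_lt_trans xb.
  by move=> [/andP[-> _] ->].
rewrite E1 [in RHS]integral_mkcond; congr fine; apply: eq_integral => y _.
rewrite /patch; case: ifPn => yD; last first.
  rewrite integral0_eq// => x _; rewrite /f/= (indicE _ D).
  by rewrite (negbTE yD) mul0r mulr0.
transitivity (\int[leb]_(x in [set x : R | (y <= x)%R]) ((EFin \o h) \_ D) x)%E.
  rewrite [RHS]integral_mkcond; apply: eq_integral => x _.
  rewrite /f/= (indicE _ D) yD/= mul1r indicE.
  rewrite restrict_EFin /patch/= /L.
  have -> : ((x, y) \in [set z : mR * mR | z.2 <= z.1]) = (y <= x).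
    by apply/idP/idP; rewrite inE.
  have -> : (x \in [set x : R | (y : R) <= x]) = (y <= x).
    by apply/idP/idP; rewrite inE.
  by case: ifPn => _; case: ifPn => _; rewrite ?(mulr1, mulr0, mul0r).
rewrite -integral_mkcondr.
have -> : [set x : R | (y : R) <= x] `&` D = `[y, b[%classic.
  move: yD; rewrite inE/= in_itv/= => /andP[ay yb].
  apply/seteqP; split => x /=; rewrite /D/= !in_itv/=.
    by move=> [-> /andP[_ ->]].
  by move=> /andP[yx ->]; split => //; rewrite (lt_le_trans ay yx).
rewrite /= fineK//; apply: integrable_fin_num => //.
apply: (integrableS mD) => //.
move: yD; rewrite inE/= in_itv/= => /andP[ay yb] x /=.
by rewrite /D/= !in_itv/= => /andP[yx ->]; rewrite (lt_le_trans ay yx).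
Qed.

(** Restricting [m] to the whole line with [mfrestr] changes no value, but turns the finiteness
    hypothesis into the finite measure structure under which the previous result is stated. *)
Lemma fubini_primitive (a b : R) (h : R -> R) (m : {measure set mR -> \bar R}) :
    (m [set: mR] < +oo)%E -> leb.-integrable `]a, b[ (EFin \o h) ->
  \int[leb]_(x in `]a, b[) (h x * fine (m `]a, x]%classic)) =
  \int[m]_(y in `]a, b[) (\int[leb]_(x in `[y, b[) h x).
Proof.
move=> mfin ih.
have E A : mfrestr measurableT mfin A = m A by rewrite /mfrestr /mrestr setIT.
apply: etrans (etrans (fubini_primitive_finite (mfrestr measurableT mfin) ih) _).
  by apply: eq_Rintegral => x _; congr (_ * fine _); exact/esym/E.
by congr fine; apply: eq_measure_integral => A _ _; exact: E.
Qed.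

End fubini_primitive.

(** * Test functions and the du Bois-Reymond lemma *)

Section smooth_functions.
Context (R : realType).
Implicit Types (f g : R -> R) (n k : nat).

(** The derivative is carried as a witness, so that closure under sums, products and affine
    substitutions follows by induction without computing iterated derivatives. Smoothness is
    [ndiff n f] for every [n]. *)
Fixpoint ndiff n f : Prop :=
  if n is m.+1 then exists2 g : R -> R, forall x : R, is_derive x (1 : R) f (g x) & ndiff m g
  else True.

Lemma ndiffW n f : ndiff n.+1 f -> ndiff n f.
Proof.
elim: n f => // n IH f [g fg hg].
by exists g => //; exact: IH.
Qed.

Lemma ndiff_cst n (c : R) : ndiff n (fun=> c).
Proof.
elim: n c => // n IH c; exists (fun=> 0) => // x.
exact: is_derive_cst.
Qed.

Lemma ndiffD n f g : ndiff n f -> ndiff n g -> ndiff n (fun x => f x + g x).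
Proof.
elim: n f g => // n IH f g [f' ff' hf] [g' gg' hg].
exists (fun x => f' x + g' x); last exact: IH.
by move=> x; apply: is_deriveD.
Qed.

Lemma ndiffM n f g : ndiff n f -> ndiff n g -> ndiff n (fun x => f x * g x).
Proof.
elim: n f g => // n IH f g /[dup] /ndiffW hf [f' ff' hf'] /[dup] /ndiffW hg [g' gg' hg'].
exists (fun x => f x * g' x + g x * f' x); last by apply: ndiffD; exact: IH.
by move=> x; apply: is_deriveM.
Qed.

Lemma is_derive_affine f (s t x df : R) :
  is_derive (s * x + t) (1 : R) f df -> is_derive x (1 : R) (fun x => f (s * x + t)) (s * df).
Proof.
move=> fdf; have hs : is_derive x (1 : R) (fun x => s * x + t) s.
  apply: is_derive_eq (is_deriveD (is_deriveZ s (is_derive_id x (1 : R)))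
    (is_derive_cst t x (1 : R))) _.
  by rewrite /GRing.scale/= mulr1 addr0.
have := @is_derive1_comp _ f (fun x => s * x + t) x df s fdf hs.
by rewrite mulrC.
Qed.

Lemma ndiff_affine n f (s t : R) : ndiff n f -> ndiff n (fun x => f (s * x + t)).
Proof.
elim: n f => // n IH f [f' ff' hf].
exists (fun x => s * f' (s * x + t)); last by apply: ndiffM; [exact: ndiff_cst|exact: IH].
by move=> x; exact: is_derive_affine.
Qed.

Lemma ndiff_derivable f : (forall n, ndiff n f) -> forall n x, derivable (f^`(n)) x 1.
Proof.
move=> hf n; have {hf} := hf n.+1.
elim: n f => [|n IH] f [g fg hg] x; first exact: ex_derive.
rewrite derive1Sn; have -> : f^`()%classic = g.
  by apply/funext => y; rewrite derive1E; exact: derive_val.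
exact: IH.
Qed.

(* x^-k e^(-1/x) on x > 0, extended by 0: a family closed under differentiation,
   up to linear combinations. *)
Definition flat k (x : R) : R := if 0 < x then (x^-1) ^+ k * expR (- x^-1) else 0.

Lemma flat_ge0 k x : 0 <= flat k x.
Proof.
rewrite /flat; case: ifPn => // x0.
by rewrite mulr_ge0 ?expR_ge0// exprn_ge0// invr_ge0 ltW.
Qed.

(** This exhibits [flat k.+1] as the difference quotient of [flat k] at 0, so differentiability
    there reduces, in Caratheodory's form, to continuity of [flat k.+1] at 0. *)
Lemma flatS k (x : R) : flat k x = flat k.+1 x * x.
Proof.
rewrite /flat; case: ifPn => x0; last by rewrite mul0r.
rewrite exprS; move: (x^-1 ^+ k) (expR _) => A B; field.
by rewrite gt_eqF.
Qed.

(** The Taylor term of order k + 1 of e^(1/x) beats x^-k by one power of x, which is enough for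
    continuity at 0. *)
Lemma flat_le k (x : R) : flat k x <= k.+1`!%:R * `|x|.
Proof.
rewrite /flat; case: ifPn => x0; last by rewrite mulr_ge0.
have xi : 0 < x^-1 by rewrite invr_gt0.
have := expR_ge1Dxn k (ltW xi) => h.
have h1 : x^-1 ^+ k.+1 <= k.+1`!%:R * expR (x^-1).
  rewrite mulrC -ler_pdivrMr ?ltr0n ?fact_gt0//.
  by apply: le_trans h; rewrite lerDr.
rewrite expRN ler_pdivrMr ?expR_gt0// gtr0_norm//.
rewrite mulrAC -ler_pdivrMr//.
by rewrite -exprSr.
Qed.

Lemma flat_continuous0 k : {for 0, continuous (flat k)}.
Proof.
have f0 : flat k 0 = 0 by rewrite /flat ltxx.
apply/cvgrPdist_lt => e e0; rewrite f0.
have M0 : 0 < (k.+1`!%:R : R) by rewrite ltr0n fact_gt0.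
near=> x; rewrite sub0r normrN ger0_norm ?flat_ge0//.
apply: (le_lt_trans (flat_le k x)).
rewrite -ltr_pdivlMl//; near: x.
apply: cvgr0_norm_lt; [exact: cvg_id|by rewrite mulr_gt0 ?invr_gt0].
Unshelve. all: by end_near. Qed.

Lemma is_derive_flat k (x : R) :
  is_derive x (1 : R) (flat k) (flat k.+2 x - k%:R * flat k.+1 x).
Proof.
have [x0|x0|->] := ltgtP x 0.
- apply: (@near_eq_is_derive _ _ _ (fun=> 0)).
    near=> y; rewrite /flat ltNge ltW//=.
    by near: y; exact: lt_nbhsl.
  rewrite /flat [0 < x]ltNge ltW//= mulr0 subr0.
  exact: is_derive_cst.
- apply: (@near_eq_is_derive _ _ _ (fun x : R => (x^-1) ^+ k * expR (- x^-1))).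
    near=> y; rewrite /flat ifT//.
    by near: y; exact: lt_nbhsr.
  have xV : is_derive x (1 : R) (fun x : R => x^-1) (- x ^- 2).
    apply: is_derive_eq (@is_deriveV _ id x _ _ _ (is_derive_id x (1 : R))) _.
      by rewrite gt_eqF.
    by rewrite /GRing.scale/= mulr1.
  have xe : is_derive x (1 : R) (fun x : R => expR (- x^-1)) (x ^- 2 * expR (- x^-1)).
    have h := @is_derive1_comp _ expR (fun x => - x^-1) x _ _ (is_derive_expR _) (is_deriveN xV).
    apply: is_derive_eq h _.
    by rewrite opprK mulrC.
  have xk : is_derive x (1 : R) (fun x : R => x^-1 ^+ k) ((k%:R * x^-1 ^+ k.-1) * - x ^- 2).
    have := is_deriveX k xV; congr (is_derive _ _ _ _).
    by apply/funext => y; rewrite exprfctE.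
  apply: is_derive_eq (is_deriveM xk xe) _.
  rewrite /flat x0 /GRing.scale/=.
  rewrite -!exprVn; move: (x^-1) (expR _) => y e.
  by clear; case: k => [|k] /=; rewrite ?exprS; ring.
- have f0 j : flat j 0 = 0 by rewrite /flat ltxx.
  rewrite !f0 mulr0 subr0; apply/is_derive1_caratheodory; exists (flat k.+1); split.
  + by move=> z; rewrite f0 !subr0 flatS.
  + exact: flat_continuous0.
  + exact: f0.
Unshelve. all: by end_near. Qed.

Lemma ndiff_flat n k : ndiff n (flat k).
Proof.
elim: n k => // n IH k.
exists (fun x => flat k.+2 x + (- k%:R) * flat k.+1 x).
  by move=> x; rewrite mulNr; exact: is_derive_flat.
by apply: ndiffD => //; apply: ndiffM => //; exact: ndiff_cst.
Qed.

End smooth_functions.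

Section test_functions.
Context (R : realType).
Local Notation leb := (@lebesgue_measure R).
Local Notation mR := (measurableTypeR R).
Implicit Types (f g phi psi : R -> R).

Lemma is_derive_continuous f (x df : R) :
  is_derive x (1 : R) f df -> {for x, continuous f}.
Proof.
by move=> [/derivable1_diffP dfx _]; exact: differentiable_continuous.
Qed.

Lemma ndiff_continuous f : ndiff 1 f -> continuous f.
Proof. by move=> [g fg _] x; exact: is_derive_continuous (fg x). Qed.

Lemma continuous_integrable_itv f (x y : R) :
  continuous f -> leb.-integrable `[x, y] (EFin \o f).
Proof.
move=> cf; apply: continuous_compact_integrable; first exact: segment_compact.
exact: continuous_subspaceT.
Qed.

Lemma ndiff_test_function (a b c d : R) phi :
    a < c -> d < b -> (forall n, ndiff n phi) ->
    (forall x, x < c -> phi x = 0) -> (forall x, d < x -> phi x = 0) ->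
  test_function a b phi.
Proof.
move=> ac db sphi phic phid.
have supp : closure [set x | phi x != 0] `<=` `[c, d]%classic.
  rewrite [X in _ `<=` X](closure_id _).1; last exact: itv_closed.
  apply: closure_subset => x /= /eqP phix; rewrite in_itv/=.
  by rewrite !leNgt; apply/andP; split; apply/negP => h; apply: phix; auto.
split; first exact: ndiff_derivable.
- apply: (subclosed_compact _ _ supp); first exact: closed_closure.
  exact: segment_compact.
- move=> x /supp/=; rewrite !in_itv/= => /andP[cx xd].
  by rewrite (lt_le_trans ac cx) (le_lt_trans xd db).
Qed.

Lemma Rdominated_convergence (D : set mR) (f_ : nat -> R -> R) f g :
    measurable D -> (forall n, measurable_fun D (f_ n)) -> measurable_fun D f ->
    (forall x, D x -> f_ n x @[n --> \oo] --> f x) ->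
    leb.-integrable D (EFin \o g) ->
    (forall n x, D x -> `|f_ n x| <= g x) ->
  \int[leb]_(x in D) f_ n x @[n --> \oo] --> \int[leb]_(x in D) f x.
Proof.
move=> mD mf_ mf f_f ig f_g.
have [||||ifn _ cv] := @dominated_convergence _ mR R leb D mD
  (fun n => EFin \o f_ n) (EFin \o f) (EFin \o g) _ _ _ ig.
- by move=> n; exact/measurable_EFinP.
- exact/measurable_EFinP.
- by apply: aeW => x Dx; apply: cvg_EFin; [exact: nearW|exact: f_f].
- by apply: aeW => x n Dx; rewrite /= lee_fin; exact: f_g.
- apply: fine_cvg; rewrite fineK//; exact: integrable_fin_num.
Qed.

(* The zero mean of [psi] makes its primitive vanish beyond [d]. *)
Lemma test_function_primitive (a b c d : R) psi :
    a < c -> d < b -> (forall n, ndiff n psi) ->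
    (forall x, x < c -> psi x = 0) -> (forall x, d < x -> psi x = 0) ->
    \int[leb]_(x in `]a, b[) psi x = 0 ->
  exists2 phi, test_function a b phi & phi^`()%classic = psi.
Proof.
move=> ac db spsi psic psid psi0.
have cpsi : continuous psi by exact: ndiff_continuous.
(* The base point lies strictly to the left of the support, so the fundamental theorem of calculus
   applies at every point from [c] on, including [c]. *)
pose phi x := \int[leb]_(t in `[c - 1, x]) psi t.
have phic x : x < c -> phi x = 0.
  move=> xc; rewrite /phi /Rintegral integral0_eq// => t /=.
  by rewrite in_itv/= => /andP[_ tx]; rewrite psic// (le_lt_trans tx).
have phid x : d < x -> phi x = 0.
  move=> dx; rewrite /phi -psi0 Rintegral_mkcond [RHS]Rintegral_mkcond.
  apply: eq_Rintegral => t _; rewrite /patch !mem_setE !in_itv/=.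
  have [tc|ct] := ltP t c; first by rewrite psic//; do ! case: ifP => //.
  have [td|dt] := leP t d; last by rewrite psid//; do ! case: ifP => //.
  by rewrite (le_trans _ ct) ?lerBlDr ?lerDl//= (le_trans td (ltW dx)) (lt_le_trans ac ct) (le_lt_trans td db).
have dphi x : is_derive x (1 : R) phi (psi x).
  have [xc|cx] := ltP x c.
    rewrite psic//; apply: (@near_eq_is_derive _ _ _ (fun=> 0)).
    by near=> y; rewrite phic//; near: y; exact: lt_nbhsl.
  have [||| dp pE] := @continuous_FTC1 R psi (BLeft (c - 1)) x (x + 1) _ _ _ (cpsi x).
  - by rewrite ltrDl.
  - exact: continuous_integrable_itv.
  - by rewrite /= lte_fin (lt_le_trans _ cx)// ltrBlDr ltrDl.
  exact: (DeriveDef dp (etrans (esym (derive1E _ _)) pE)).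
exists phi.
  apply: (ndiff_test_function ac db) => //.
  by case=> // n; exists psi.
by apply/funext => x; rewrite derive1E; exact: derive_val.
Unshelve. all: by end_near. Qed.

Definition bump n (c d x : R) : R :=
  flat 0 (n.+1%:R * x + (- n.+1%:R * c - 1)) * flat 0 (- n.+1%:R * x + (n.+1%:R * d - 1)).

Lemma ndiff_bump m n c d : ndiff m (bump n c d).
Proof. by apply: ndiffM; apply: ndiff_affine; exact: ndiff_flat. Qed.

Lemma flat0_le1 (x : R) : flat 0 x <= 1.
Proof.
rewrite /flat; case: ifPn => // x0.
by rewrite expr0 mul1r -[leRHS]expR0 ler_expR oppr_le0 invr_ge0 ltW.
Qed.

Lemma bump_ge0 n c d x : 0 <= bump n c d x.
Proof. by rewrite mulr_ge0// flat_ge0. Qed.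

Lemma bump_le1 n c d x : bump n c d x <= 1.
Proof. by rewrite -[leRHS]mulr1 ler_pM// ?flat_ge0// flat0_le1. Qed.

Lemma bump_out n (c d x : R) : x < c + n.+1%:R^-1 \/ d - n.+1%:R^-1 < x ->
  bump n c d x = 0.
Proof.
have n0 : 0 < n.+1%:R :> R by rewrite ltr0n.
move=> [h|h]; rewrite /bump /flat.
  rewrite [X in X * _]ifF ?mul0r//; apply/negbTE; rewrite -leNgt.
  by move: h; rewrite -ltrBlDl -(ltr_pM2l n0) mulfV ?gt_eqF// mulrBr; lra.
rewrite [X in _ * X]ifF ?mulr0//; apply/negbTE; rewrite -leNgt.
by move: h; rewrite ltrBlDl -ltrBlDr -(ltr_pM2l n0) mulfV ?gt_eqF// mulrBr; lra.
Qed.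

Lemma flat0_cvg1 (s t : R) : 0 < s -> flat 0 (n.+1%:R * s + t) @[n --> \oo] --> (1 : R).
Proof.
move=> s0.
have yoo : n.+1%:R * s + t @[n --> \oo] --> +oo.
  apply/cvgryPge => A; near=> n.
  rewrite -lerBlDr -ler_pdivrMr// (@le_trans _ _ n%:R)// ?ler_nat//.
  by near: n; exact: nbhs_infty_ger.
have y0 : \forall n \near \oo, 0 < n.+1%:R * s + t by move/cvgryPgt : yoo.
apply: (@squeeze_cvgr _ _ _ _ (fun n => 1 - (n.+1%:R * s + t)^-1) (fun=> 1)).
- apply: filterS y0 => n y0; rewrite flat0_le1 andbT /flat y0 expr0 mul1r.
  exact: expR_ge1Dx.
- rewrite -[X in _ --> X]subr0; apply: cvgB; first exact: cvg_cst.
  exact/gtr0_cvgV0.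
- exact: cvg_cst.
Unshelve. all: by end_near. Qed.

Lemma bump_cvg (c d x : R) : bump n c d x @[n --> \oo] --> (\1_(`]c, d[%classic) x : R).
Proof.
rewrite indicE; have [|] := boolP (x \in `]c, d[%classic).
  rewrite inE/= in_itv/= => /andP[cx xd]; rewrite -[_%:R]mulr1.
  apply: cvgM.
    have -> : (fun n => flat 0 (n.+1%:R * x + (- n.+1%:R * c - 1))) =
        (fun n => flat 0 (n.+1%:R * (x - c) + -1)).
      by apply/funext => n; congr (flat 0 _); ring.
    by apply: flat0_cvg1; rewrite subr_gt0.
  have -> : (fun n => flat 0 (- n.+1%:R * x + (n.+1%:R * d - 1))) =
      (fun n => flat 0 (n.+1%:R * (d - x) + -1)).
    by apply/funext => n; congr (flat 0 _); ring.
  by apply: flat0_cvg1; rewrite subr_gt0.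
rewrite notin_setE/= in_itv/= => /negP; rewrite negb_and -!leNgt => h.
apply: (@cvg_trans _ ((fun=> 0) @ \oo)); last exact: cvg_cst.
apply: near_eq_cvg; near=> n; rewrite bump_out//.
have n0 : 0 < n.+1%:R^-1 :> R by rewrite invr_gt0.
case/orP: h => h; [left|right].
  by rewrite (le_lt_trans h)// ltrDl.
by rewrite (lt_le_trans _ h)// ltrBlDr ltrDl.
Unshelve. all: by end_near. Qed.

End test_functions.

Section du_bois_reymond.
Context (R : realType).
Local Notation leb := (@lebesgue_measure R).
Local Notation mR := (measurableTypeR R).
Implicit Types (a b c d : R) (g : R -> R).

Lemma measurable_bump n c d (D : set mR) : measurable_fun D (bump n c d : mR -> R).
Proof.
apply: measurable_funS (measurableT) _ _ => //.
apply: continuous_measurable_fun; apply: ndiff_continuous; exact: ndiff_bump.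
Qed.

Lemma integral_bump_cvg a b c d g : leb.-integrable `]a, b[ (EFin \o g) ->
  a <= c -> d <= b ->
  \int[leb]_(x in `]a, b[) (g x * bump n c d x) @[n --> \oo] -->
  \int[leb]_(x in `]c, d[) g x.
Proof.
move=> ig ac db.
have mD : measurable (`]a, b[%classic : set mR) by exact: measurable_itv.
have mg : measurable_fun (`]a, b[%classic : set mR) g.
  by apply/measurable_EFinP; exact: (measurable_int leb).
have -> : \int[leb]_(x in `]c, d[) g x = \int[leb]_(x in `]a, b[) (g x * \1_(`]c, d[%classic) x).
  rewrite [LHS]Rintegral_mkcond [RHS]Rintegral_mkcond.
  apply: eq_Rintegral => x _; rewrite /patch indicE !mem_setE !in_itv/=.
  case: ifPn => [/andP[cx xd]|].
    by rewrite (le_lt_trans ac cx) (lt_le_trans xd db) mulr1.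
  by rewrite mulr0 if_same.
apply: (@Rdominated_convergence _ _ _ _ (fun x => `|g x|)) => //.
- by move=> n; apply: measurable_funM => //; exact: measurable_bump.
- apply: measurable_funM => //; apply: measurable_indic; exact: measurable_itv.
- by move=> x _; apply: cvgM; [exact: cvg_cst|exact: bump_cvg].
- exact: integrable_norm.
- by move=> n x _; rewrite normrM [X in _ * X]ger0_norm ?bump_ge0// ler_piMr// bump_le1.
Qed.

Lemma integral_itv_cst (k c d : R) : c <= d -> \int[leb]_(x in `]c, d[) k = k * (d - c).
Proof.
move=> cd; rewrite Rintegral_cst//.
transitivity (k * fine (@lebesgue_measure R `]c, d[%classic)) => //.
rewrite lebesgue_measure_itv/= lte_fin; case: ltP => // dc.
by rewrite (@le_anti _ _ c d) ?cd ?dc// subrr.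
Qed.

Lemma integrable_bump n a b c d g : leb.-integrable `]a, b[ (EFin \o g) ->
  leb.-integrable `]a, b[ (EFin \o (fun x => g x * bump n c d x)).
Proof.
move=> ig; apply: (le_integrable _ _ _ ig); first exact: measurable_itv.
  apply/measurable_EFinP; apply: measurable_funM; last exact: measurable_bump.
  by apply/measurable_EFinP; exact: (measurable_int leb).
move=> x _ /=; rewrite lee_fin normrM [X in _ * X]ger0_norm ?bump_ge0//.
by rewrite ler_piMr// bump_le1.
Qed.

Lemma integrable_itv_cst (k a b : R) : leb.-integrable `]a, b[ (EFin \o (fun=> k)).
Proof.
apply: measurable_bounded_integrable; first exact: measurable_itv.
- suff : (@lebesgue_measure R `]a, b[%classic < +oo)%E by [].
  by rewrite lebesgue_measure_itv/=; case: ifP => // _; rewrite -EFinD ltry.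
- exact: measurable_cst.
- exact: bounded_cst.
Qed.

(** Two bumps, on []c, d[] and on []a, b[], each weighted by the integral of the other, have a
    difference of mean zero, which is therefore the derivative of a test function. Letting the bumps
    tend to indicators gives the claim; the cross-multiplied form avoids dividing by integrals of
    bumps. *)
Lemma integral_annihilator_test a b g : a < b -> leb.-integrable `]a, b[ (EFin \o g) ->
    (forall phi, test_function a b phi ->
      \int[leb]_(x in `]a, b[) (g x * phi^`()%classic x) = 0) ->
  forall c d, a <= c -> c <= d -> d <= b ->
  (b - a) * \int[leb]_(x in `]c, d[) g x = (d - c) * \int[leb]_(x in `]a, b[) g x.
Proof.
move=> ab ig g0 c d ac cd db.
have mD : measurable (`]a, b[%classic : set mR) by exact: measurable_itv.
have i1 := integrable_itv_cst 1 a b.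
pose I h n u v := \int[leb]_(x in `]a, b[) (h x * bump n u v x).
have EI n : I (fun=> 1) n a b * I g n c d = I (fun=> 1) n c d * I g n a b.
  pose p := I (fun=> 1) n a b; pose q := I (fun=> 1) n c d.
  have n0 : 0 < n.+1%:R^-1 :> R by rewrite invr_gt0.
  have ip u v (k : R) : leb.-integrable `]a, b[ (EFin \o (fun x => k * bump n u v x)).
    exact: integrable_bump (integrable_itv_cst k a b).
  have [||||||phi tphi phiE] :=
    @test_function_primitive R a b (a + n.+1%:R^-1) (b - n.+1%:R^-1)
      (fun x => p * bump n c d x + - q * bump n a b x).
  - by rewrite ltrDl.
  - by rewrite ltrBlDr ltrDl.
  - by move=> m; apply: ndiffD; apply: ndiffM; try exact: ndiff_cst; exact: ndiff_bump.
  - move=> x xa; rewrite !bump_out ?mulr0 ?addr0//; left => //.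
    by rewrite (lt_le_trans xa)// lerD2r.
  - move=> x xb; rewrite !bump_out ?mulr0 ?addr0//; right => //.
    by rewrite (le_lt_trans _ xb)// lerD2r.
  - rewrite RintegralD// ?(ip _ _ _)//.
    have E u v (k : R) : \int[leb]_(x in `]a, b[) (k * bump n u v x) = k * I (fun=> 1) n u v.
      rewrite /I -RintegralZl//.
      by apply: eq_Rintegral => x _; rewrite mul1r.
    by rewrite !E -/p -/q; ring.
  have := g0 _ tphi; rewrite phiE.
  have ig' u v (k : R) : leb.-integrable `]a, b[ (EFin \o (fun x => k * (g x * bump n u v x))).
    exact: (@integrableZl _ _ _ leb _ mD k _ (integrable_bump n u v ig)).
  under eq_Rintegral do rewrite mulrDr mulrCA [X in _ + X]mulrCA.
  rewrite (RintegralD mD (ig' _ _ _) (ig' _ _ _)).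
  rewrite (RintegralZl _ mD (integrable_bump n c d ig)).
  rewrite (RintegralZl _ mD (integrable_bump n a b ig)) => /eqP.
  by rewrite mulNr subr_eq0 => /eqP.
have cv h u v : leb.-integrable `]a, b[ (EFin \o h) -> a <= u -> v <= b ->
  I h n u v @[n --> \oo] --> \int[leb]_(x in `]u, v[) h x.
  exact: integral_bump_cvg.
rewrite -[b - a]mul1r -[d - c]mul1r -!integral_itv_cst// ?(ltW ab)//.
have l1 : I (fun=> 1) n a b * I g n c d @[n --> \oo] -->
    \int[leb]_(x in `]a, b[) 1 * \int[leb]_(x in `]c, d[) g x.
  by apply: cvgM; exact: cv.
have l2 : I (fun=> 1) n c d * I g n a b @[n --> \oo] -->
    \int[leb]_(x in `]c, d[) 1 * \int[leb]_(x in `]a, b[) g x.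
  by apply: cvgM; exact: cv.
have EIf : (fun n => I (fun=> 1) n a b * I g n c d) =
    (fun n => I (fun=> 1) n c d * I g n a b) by apply/funext.
rewrite EIf in l1.
by rewrite -(cvg_lim (@Rhausdorff R) l1) (cvg_lim (@Rhausdorff R) l2).
Qed.

(** With [c = a], the previous identity says that the primitive of [g] is affine of slope [k], the
    mean of [g]; Lebesgue differentiation then identifies [g] with [k] almost everywhere. *)
Lemma du_bois_reymond a b g : a < b -> leb.-integrable `]a, b[ (EFin \o g) ->
    (forall phi, test_function a b phi ->
      \int[leb]_(x in `]a, b[) (g x * phi^`()%classic x) = 0) ->
  exists k, {ae leb, forall x, `]a, b[%classic x -> g x = k}.
Proof.
move=> ab ig g0.
have mD : measurable (`]a, b[%classic : set mR) by exact: measurable_itv.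
have key := integral_annihilator_test ab ig g0.
pose k := (\int[leb]_(x in `]a, b[) g x) / (b - a).
have ba : b - a != 0 by rewrite subr_eq0 gt_eqF.
have Fk x : a <= x -> x <= b -> \int[leb]_(t in `]a, x[) g t = k * (x - a).
  move=> ax xb; have := key a x (lexx _) ax xb => E.
  by rewrite /k mulrAC [_ * (x - a)]mulrC -E mulrAC mulfV// mul1r.
exists k; pose G := g \_ `]a, b[.
have iG : leb.-integrable setT (EFin \o G).
  by move/integrable_mkcond : ig => /(_ mD); rewrite restrict_EFin.
have iGx y : leb.-integrable [set` Interval (BRight a) (BRight y)] (EFin \o G).
  by apply: integrableS iG => //; exact: measurable_itv.
have lG : locally_integrable [set: R] G.
  apply: open_integrable_locally => //; exact: openT.
move: (FTC1 iGx lG); apply: filterS; first exact: (ae_filter_ringOfSetsType leb).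
move=> x /= + xab.
move: (xab); rewrite in_itv/= => /andP[ax xb].
rewrite lte_fin ax => /(_ isT)[_].
rewrite {2}/G /patch mem_set// => <-.
rewrite derive1E; apply: (etrans (near_eq_derive (g := fun y => k * (y - a)) _ _)).
  near=> y.
  have ay : a < y by near: y; exact: lt_nbhsr.
  have yb : y < b by near: y; exact: lt_nbhsl.
  rewrite -Fk ?(ltW ay) ?(ltW yb)//.
  rewrite -Rintegral_itv_bndo_bndc.
    apply: eq_Rintegral => t; rewrite inE/= in_itv/= => /andP[at' ty].
    by rewrite /G patchE mem_set//= in_itv/= at' (lt_trans ty).
  exact: integrableS iG.
have h : is_derive x (1 : R) (fun y : R => k * (y - a)) (k * (1 - 0)).
  exact: (is_deriveZ k (is_deriveB (is_derive_id x (1 : R)) (is_derive_cst a x (1 : R)))).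
by rewrite (@derive_val _ _ _ _ _ _ _ h) subr0 mulr1.
Unshelve. all: by end_near. Qed.

End du_bois_reymond.

(** * Functions of bounded variation as primitives of their derivatives *)

Section primitive.
Context (R : realType).
Local Notation leb := (@lebesgue_measure R).
Local Notation mR := (measurableTypeR R).
Implicit Types (a b c x y : R) (nu : {charge set mR -> \bar R}).

Lemma finite_measure_shrink (m : {measure set mR -> \bar R}) (F : nat -> set mR) :
    (m [set: mR] < +oo)%E -> (forall n, measurable (F n)) ->
    (forall n k, (n <= k)%N -> F k `<=` F n) -> \bigcap_n F n = set0 ->
  forall e : R, 0 < e -> exists n, fine (m (F n)) < e.
Proof.
move=> mfin mF Fdec F0 e e0.
have mF0 n : (m (F n) < +oo)%E.
  by apply: le_lt_trans mfin; apply: le_measure; rewrite ?inE.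
have := @nonincreasing_cvg_mu _ mR R m F (mF0 0%N) mF _ _.
rewrite F0 measure0 => /(_ measurable0) h.
have {}h : (m \o F) n @[n --> \oo] --> 0%E.
  by apply: h => n k nk; exact/subsetPset/Fdec.
have [N _ hN] : \forall n \near \oo, (fine \o (m \o F)) n < e.
  exact: (cvgr_lt _ (fine_cvg h)).
by exists N; apply: hN => /=.
Qed.

Lemma finite_measure_right (m : {measure set mR -> \bar R}) x (e : R) :
    (m [set: mR] < +oo)%E -> 0 < e ->
  exists2 d : R, 0 < d & fine (m `]x, (x + d)%R]%classic) < e.
Proof.
move=> mfin e0; pose F n : set mR := `]x, (x + n.+1%:R^-1)%R]%classic.
have [||| n hn] := @finite_measure_shrink m F mfin _ _ _ e e0.
- by move=> n; exact: measurable_itv.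
- move=> n k nk z; rewrite /F/= !in_itv/= => /andP[-> zx]; rewrite (le_trans zx)//.
  by rewrite lerD2l lef_pV2 ?posrE ?ltr0n// ler_nat.
- apply/seteqP; split => // z Fz; have := Fz 0%N I; rewrite /F/= in_itv/= => /andP[xz _].
  have [k xk] := ltr_add_invr xz.
  by have := Fz k I; rewrite /F/= in_itv/= xz/= leNgt xk.
- by exists (n.+1%:R^-1).
Qed.

Lemma finite_measure_left (m : {measure set mR -> \bar R}) x (e : R) :
    (m [set: mR] < +oo)%E -> 0 < e ->
  exists2 d : R, 0 < d & fine (m `](x - d)%R, x[%classic) < e.
Proof.
move=> mfin e0; pose F n : set mR := `](x - n.+1%:R^-1)%R, x[%classic.
have [||| n hn] := @finite_measure_shrink m F mfin _ _ _ e e0.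
- by move=> n; exact: measurable_itv.
- move=> n k nk z; rewrite /F/= !in_itv/= => /andP[xz ->]; rewrite (le_lt_trans _ xz)//.
  by rewrite lerD2l lerN2 lef_pV2 ?posrE ?ltr0n// ler_nat.
- apply/seteqP; split => // z Fz; have := Fz 0%N I; rewrite /F/= in_itv/= => /andP[_ xz].
  have [k xk] := ltr_add_invr xz.
  by have := Fz k I; rewrite /F/= in_itv/= xz/= andbT ltrBlDr ltNge ltW.
- by exists (n.+1%:R^-1).
Qed.

Lemma variation_measureT_lty nu : (variation_measure nu [set: mR] < +oo)%E.
Proof. by rewrite ltey_eq variation_measure_fin. Qed.

Definition vanishes_outside a b nu :=
  forall A : set mR, measurable A -> A `&` `]a, b[ = set0 -> nu A = 0%E.

Definition primitive a nu x : R := fine (nu `]a, x]%classic).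

Lemma primitive_le nu a x : x <= a -> primitive a nu x = 0.
Proof.
move=> xa; rewrite /primitive (_ : `]a, x]%classic = set0) ?charge0//.
by apply/seteqP; split => // z /=; rewrite in_itv/= => /andP[/lt_le_trans h /h]; rewrite ltNge xa.
Qed.

Lemma primitiveB nu a x y : a <= x -> x <= y ->
  primitive a nu y - primitive a nu x = fine (nu `]x, y]%classic).
Proof.
move=> ax xy; rewrite /primitive.
have -> : `]a, y]%classic = `]a, x]%classic `|` `]x, y]%classic :> set R.
  apply/seteqP; split => z /=; rewrite !in_itv/=.
    by move=> /andP[-> ->]; rewrite andbT; case: (leP z x) => _; [left|right].
  by move=> [/andP[-> zx]|/andP[xz ->]]; rewrite ?(le_trans zx xy) ?(le_lt_trans ax xz).
have m1 : measurable (`]a, x]%classic : set mR) by exact: measurable_itv.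
have m2 : measurable (`]x, y]%classic : set mR) by exact: measurable_itv.
rewrite chargeU//; last first.
  apply/seteqP; split => // z /=; rewrite !in_itv/= => -[/andP[_ zx] /andP[xz _]].
  by move: xz; rewrite ltNge zx.
by rewrite fineD ?fin_num_measure// addrAC subrr add0r.
Qed.

Lemma le_norm_primitiveB nu a x y : a <= x -> x <= y ->
  `|primitive a nu y - primitive a nu x| <= fine (variation_measure nu `]x, y]%classic).
Proof.
move=> ax xy; rewrite primitiveB//.
have m2 : measurable (`]x, y]%classic : set mR) by exact: measurable_itv.
have fn : nu `]x, y]%classic \is a fin_num by exact: fin_num_measure.
rewrite -fine_abse// fine_le//; first by rewrite fin_num_abs abse_id -fin_num_abs.
  exact: variation_measure_fin.
exact: le_abs_variation_measure.
Qed.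

Lemma primitive_bounded nu a x :
  `|primitive a nu x| <= fine (variation_measure nu [set: mR]).
Proof.
have [xa|ax] := leP x a.
  by rewrite primitive_le// normr0 fine_ge0.
have := le_norm_primitiveB nu (lexx a) (ltW ax).
rewrite (primitive_le nu (lexx a)) subr0 => /le_trans; apply.
have m2 : measurable (`]a, x]%classic : set mR) by exact: measurable_itv.
by rewrite fine_le ?variation_measure_fin// le_measure ?inE.
Qed.

Lemma primitive_jordanE nu a x :
  primitive a nu x = fine (pos_part nu `]a, x]%classic) - fine (neg_part nu `]a, x]%classic).
Proof.
have m2 : measurable (`]a, x]%classic : set mR) by exact: measurable_itv.
by rewrite /primitive charge_jordanE// fineB// ?pos_part_fin ?neg_part_fin.
Qed.

Lemma measurable_itv_measure (m : {measure set mR -> \bar R}) a (D : set mR) :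
  (m [set: mR] < +oo)%E -> measurable D ->
  measurable_fun D (fun x => fine (m `]a, x]%classic)).
Proof.
move=> mfin mD; apply: nondecreasing_measurable => // x y xy.
have fin z : m `]a, z]%classic \is a fin_num.
  rewrite ge0_fin_numE//; apply: le_lt_trans mfin.
  by apply: le_measure; rewrite ?inE//; exact: measurable_itv.
rewrite fine_le// le_measure ?inE//; try exact: measurable_itv.
by move=> z /=; rewrite !in_itv/= => /andP[-> zx]; rewrite (le_trans zx xy).
Qed.

Lemma pos_partT_lty nu : (pos_part nu [set: mR] < +oo)%E.
Proof. by rewrite ltey_eq pos_part_fin. Qed.

Lemma neg_partT_lty nu : (neg_part nu [set: mR] < +oo)%E.
Proof. by rewrite ltey_eq neg_part_fin. Qed.

Lemma measurable_primitive nu a (D : set mR) : measurable D ->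
  measurable_fun D (primitive a nu).
Proof.
move=> mD; rewrite (_ : primitive a nu = (fun x => fine (pos_part nu `]a, x]%classic) -
  fine (neg_part nu `]a, x]%classic))); last by apply/funext => x; rewrite primitive_jordanE.
apply: measurable_funB; apply: measurable_itv_measure => //.
  exact: pos_partT_lty.
exact: neg_partT_lty.
Qed.

Lemma integrable_itv_bounded (a b M : R) (g : R -> R) :
  measurable_fun (`]a, b[%classic : set mR) g ->
  (forall x, a < x < b -> `|g x| <= M) -> leb.-integrable `]a, b[ (EFin \o g).
Proof.
move=> mg gM.
have mD : measurable (`]a, b[%classic : set mR) by exact: measurable_itv.
apply: (le_integrable mD _ _ (integrable_itv_cst M a b)).
  exact/measurable_EFinP.
by move=> x /=; rewrite in_itv/= lee_fin => /gM h; rewrite (le_trans h)// ler_norm.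
Qed.

Lemma integrableM_itv_bounded (a b M : R) (g h : R -> R) :
  leb.-integrable `]a, b[ (EFin \o h) ->
  measurable_fun (`]a, b[%classic : set mR) g ->
  (forall x, a < x < b -> `|g x| <= M) ->
  leb.-integrable `]a, b[ (EFin \o (fun x => h x * g x)).
Proof.
move=> ih mg gM.
have mD : measurable (`]a, b[%classic : set mR) by exact: measurable_itv.
apply: (le_integrable mD _ _ (@integrableZl _ _ _ leb _ mD M _ ih)).
  apply/measurable_EFinP/measurable_funM => //.
  by apply/measurable_EFinP; exact: (measurable_int leb).
move=> x /=; rewrite in_itv/= lee_fin => /gM gx.
by rewrite !normrM mulrC ler_wpM2r// (le_trans gx)// ler_norm.
Qed.

End primitive.

Section distributional_derivative.
Context (R : realType).
Local Notation leb := (@lebesgue_measure R).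
Local Notation mR := (measurableTypeR R).
Implicit Types (a b c x y : R) (nu : {charge set mR -> \bar R}) (phi : R -> R).

Lemma integral_primitive a b nu (h : R -> R) : leb.-integrable `]a, b[ (EFin \o h) ->
  \int[leb]_(x in `]a, b[) (h x * primitive a nu x) =
  charge_integral nu `]a, b[ (fun y => \int[leb]_(x in `[y, b[) h x).
Proof.
move=> ih; rewrite /charge_integral.
have mD : measurable (`]a, b[%classic : set mR) by exact: measurable_itv.
rewrite -(fubini_primitive (pos_partT_lty nu) ih) -(fubini_primitive (neg_partT_lty nu) ih).
rewrite -RintegralB//.
- by apply: eq_Rintegral => x _; rewrite primitive_jordanE mulrBr.
- apply: (integrableM_itv_bounded (M := fine (pos_part nu setT))) => //.
    exact: measurable_itv_measure (pos_partT_lty nu) mD.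
  move=> x _; rewrite ger0_norm ?fine_ge0//.
  by rewrite fine_le ?pos_part_fin ?le_measure ?inE//; exact: measurable_itv.
- apply: (integrableM_itv_bounded (M := fine (neg_part nu setT))) => //.
    exact: measurable_itv_measure (neg_partT_lty nu) mD.
  move=> x _; rewrite ger0_norm ?fine_ge0//.
  by rewrite fine_le ?neg_part_fin ?le_measure ?inE//; exact: measurable_itv.
Qed.

Lemma is_derive_test_function a b phi x :
  test_function a b phi -> is_derive x (1 : R) phi (phi^`()%classic x).
Proof.
move=> [sphi _ _]; rewrite derive1E; apply: DeriveDef => //.
exact: (sphi 0%N).
Qed.

Lemma continuous_derive_test_function a b phi :
  test_function a b phi -> continuous (phi^`()%classic).
Proof.
move=> [sphi _ _] x; apply/differentiable_continuous/derivable1_diffP.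
exact: (sphi 1%N).
Qed.

Lemma continuous_test_function a b phi : test_function a b phi -> continuous phi.
Proof.
by move=> tphi x; exact: is_derive_continuous (is_derive_test_function x tphi).
Qed.

Lemma test_function_out a b phi x : test_function a b phi -> ~ (a < x < b) -> phi x = 0.
Proof.
move=> [_ _ supp] xab; apply/eqP/negP => /negP phix; apply: xab.
have := supp x (subset_closure _); rewrite /= in_itv/=; exact.
Qed.

Lemma continuous_itv_bounded a b (g : R -> R) : {within `[a, b], continuous g} ->
  exists M, forall x, a <= x <= b -> `|g x| <= M.
Proof.
move=> cg; have : bounded_set [set g x | x in `[a, b]%classic].
  by apply/compact_bounded/continuous_compact => //; exact: segment_compact.
move=> [M [_ hM]]; exists (`|M| + 1) => x xab.
apply: (hM (`|M| + 1)); first by rewrite (le_lt_trans (ler_norm M))// ltrDl.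
by exists x => //=; rewrite in_itv.
Qed.

Lemma test_function_bounded a b phi : test_function a b phi ->
  exists M, forall x, `|phi x| <= M.
Proof.
move=> tphi.
have [M hM] := @continuous_itv_bounded a b phi
  (continuous_subspaceT (continuous_test_function tphi)).
exists `|M| => x; have [/andP[ax xb]|xab] := pselect (a < x < b); last first.
  by rewrite (test_function_out tphi xab) normr0.
by rewrite (le_trans (hM x _)) ?ler_norm// (ltW ax) ltW.
Qed.

Lemma integral_derive_test_function a b phi y : test_function a b phi -> a <= y -> y < b ->
  \int[leb]_(x in `[y, b[) (phi^`()%classic x) = - phi y.
Proof.
move=> tphi ay yb.
have cphi := continuous_test_function tphi.
have cphi' := continuous_derive_test_function tphi.
have i := continuous_integrable_itv y b cphi'.
rewrite Rintegral_itv_bndo_bndc; last first.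
  by apply: integrableS i => //; exact: subset_itv_co_cc.
rewrite /Rintegral (@continuous_FTC2 _ _ phi)//.
- rewrite (@test_function_out a b phi b tphi) ?ltxx ?andbF//=.
  by rewrite sub0r.
- exact: continuous_subspaceT.
- split.
  + by move=> x _; have [] := is_derive_test_function x tphi.
  + by apply: cvg_at_right_filter; exact: cphi.
  + by apply: cvg_at_left_filter; exact: cphi.
Qed.

Lemma charge_integralN nu a b phi : test_function a b phi ->
  charge_integral nu `]a, b[ (fun y => - phi y) = - charge_integral nu `]a, b[ phi.
Proof.
move=> tphi; have [M hM] := test_function_bounded tphi.
have mD : measurable (`]a, b[%classic : set mR) by exact: measurable_itv.
have E (m : {measure set mR -> \bar R}) : (m [set: mR] < +oo)%E ->
    \int[m]_(y in `]a, b[) (- phi y) = - \int[m]_(y in `]a, b[) phi y.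
  move=> mfin; under eq_Rintegral do rewrite -mulN1r.
  rewrite RintegralZl// ?mulN1r//.
  apply: measurable_bounded_integrable => //.
  - by apply: le_lt_trans mfin; rewrite le_measure ?inE.
  - apply: measurable_funS (measurableT) _ _ => //.
    apply: continuous_measurable_fun; exact: continuous_test_function tphi.
  - exists M; split; first by rewrite num_real.
    by move=> N MN x _; exact: le_trans (hM x) (ltW MN).
by rewrite /charge_integral (E _ (pos_partT_lty nu)) (E _ (neg_partT_lty nu)) opprB opprK addrC.
Qed.

(** By Fubini, the integral of phi' times the primitive is the integral against [nu] of y -> int_y^b
    phi' = - phi(y). The constant [c] drops out because phi' has mean zero. *)
Lemma distr_derivative_primitive a b c nu : a < b -> vanishes_outside a b nu ->
  is_distr_derivative a b (fun x => c + primitive a nu x) nu.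
Proof.
move=> ab nu0; split=> // phi tphi.
have mD : measurable (`]a, b[%classic : set mR) by exact: measurable_itv.
have iphi' : leb.-integrable `]a, b[ (EFin \o phi^`()%classic).
  apply: (integrableS _ _ _ (continuous_integrable_itv a b (continuous_derive_test_function tphi))) => //.
  exact: subset_itv_oo_cc.
transitivity (\int[leb]_(x in `]a, b[) (c * phi^`()%classic x + phi^`()%classic x * primitive a nu x)).
  by apply: eq_Rintegral => x _; rewrite mulrDl [primitive _ _ _ * _]mulrC.
rewrite RintegralD//.
- rewrite RintegralZl// integral_primitive//.
  have -> : \int[leb]_(x in `]a, b[) phi^`()%classic x = 0.
    rewrite Rintegral_itv_obnd_cbnd//.
    by rewrite (integral_derive_test_function tphi)// (test_function_out tphi) ?oppr0// ltxx.
  rewrite mulr0 add0r -(charge_integralN nu tphi).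
  by congr (_ - _); apply: eq_Rintegral => y; rewrite inE/= in_itv/= => /andP[ay yb];
    rewrite (integral_derive_test_function tphi)// ltW.
- exact: (@integrableZl _ _ _ leb _ mD c _ iphi').
- apply: (integrableM_itv_bounded (M := fine (variation_measure nu setT))) => //.
    exact: measurable_primitive.
  by move=> x _; exact: primitive_bounded.
Qed.

Lemma integrable_primitive a b c nu :
  leb.-integrable `]a, b[ (EFin \o (fun x => c + primitive a nu x)).
Proof.
apply: (integrable_itv_bounded (M := `|c| + fine (variation_measure nu setT))).
  apply: measurable_funD => //; exact: measurable_primitive.
by move=> x _; rewrite (le_trans (ler_normD _ _))// lerD2l primitive_bounded.
Qed.

Lemma BV_primitive a b c nu : a < b -> vanishes_outside a b nu ->
  BV a b (fun x => c + primitive a nu x).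
Proof.
move=> ab nu0; split; first exact: integrable_primitive.
by exists nu; exact: distr_derivative_primitive.
Qed.

(** [u] and the primitive of [nu] pair equally with the derivative of every test function, so their
    difference is constant almost everywhere by [du_bois_reymond]. *)
Lemma BV_primitiveP a b (u : R -> R) nu : a < b ->
    leb.-integrable `]a, b[ (EFin \o u) -> is_distr_derivative a b u nu ->
  exists c, {ae leb, forall x, `]a, b[%classic x -> u x = c + primitive a nu x}.
Proof.
move=> ab iu dnu.
have mD : measurable (`]a, b[%classic : set mR) by exact: measurable_itv.
have ip : leb.-integrable `]a, b[ (EFin \o primitive a nu).
  have := integrable_primitive a b 0 nu.
  by apply: eq_integrable => // x _; rewrite /= add0r.
have [|phi tphi|c hc] := @du_bois_reymond R a b (fun x => u x - primitive a nu x) ab.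
- exact: (integrableB mD iu ip).
- have [_ dp] := @distr_derivative_primitive a b 0 nu ab dnu.1.
  have := dnu.2 _ tphi; have := dp _ tphi.
  under eq_Rintegral do rewrite add0r.
  move=> E1 E2.
  have cphi' := continuous_derive_test_function tphi.
  have mphi' : measurable_fun (`]a, b[%classic : set mR) phi^`()%classic.
    apply: measurable_funS (measurableT) _ _ => //.
    exact: continuous_measurable_fun.
  have [M hM] := @continuous_itv_bounded a b _ (continuous_subspaceT cphi').
  have {}hM x : a < x < b -> `|phi^`()%classic x| <= M.
    by move=> /andP[/ltW ax /ltW xb]; apply: hM; rewrite ax.
  transitivity (\int[leb]_(x in `]a, b[) (u x * phi^`()%classic x - primitive a nu x * phi^`()%classic x)).
    by apply: eq_Rintegral => x _; rewrite mulrBl.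
  rewrite RintegralB//; first by rewrite E1 E2 subrr.
    exact: (integrableM_itv_bounded (M := M)).
  exact: (integrableM_itv_bounded (M := M)).
- exists c; move: hc; apply: filterS; first exact: (ae_filter_ringOfSetsType leb).
  by move=> x /= hx /hx <-; rewrite subrK.
Qed.

End distributional_derivative.

(** * Uniqueness of the measure derivative *)

Section uniqueness.
Context (R : realType).
Local Notation leb := (@lebesgue_measure R).
Local Notation mR := (measurableTypeR R).
Implicit Types (a b c x y : R) (nu : {charge set mR -> \bar R}).

Lemma measure_eq_ocitv (m1 m2 : {measure set mR -> \bar R}) :
    (forall x y, m1 `]x, y]%classic = m2 `]x, y]%classic) ->
    (forall x y, (m1 `]x, y]%classic < +oo)%E) ->
  forall A, measurable A -> m1 A = m2 A.
Proof.
move=> m12 m1fin.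
apply: (@measure_unique _ R mR (@ocitv R) (fun n => `](- (n%:R : R)), n%:R]%classic)) => //.
- exact: ocitvI.
- by move=> i; exact: is_ocitv.
- apply/seteqP; split => // x _.
  have [n xn] : exists n : nat, `|x| < n%:R.
    by exists (Num.bound `|x|); exact: archi_boundP.
  exists n => //=; rewrite in_itv/=.
  by move: xn; rewrite ltr_norml => /andP[-> /ltW].
- by move=> A [[x y] _ <-]; exact: m12.
Qed.

Lemma ae_itv_exists a b (P : R -> Prop) x y :
    {ae leb, forall z, `]a, b[%classic z -> P z} -> a <= x -> x < y -> y <= b ->
  exists2 z, x < z < y & P z.
Proof.
move=> [A [mA A0 AP]] ax xy yb.
apply: contrapT => nP.
have xyA : `]x, y[%classic `<=` A.
  move=> z /=; rewrite in_itv/= => zxy; apply: AP => /= Pz.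
  apply: nP; exists z => //; apply: Pz; rewrite in_itv/=.
  by case/andP: zxy => xz zy; rewrite (le_lt_trans ax xz) (lt_le_trans zy yb).
have : (@lebesgue_measure R `]x, y[%classic <= 0)%E.
  by rewrite -A0; apply: le_measure; rewrite ?inE//; exact: measurable_itv.
rewrite lebesgue_measure_itv/= lte_fin xy -EFinD lee_fin subr_le0 leNgt.
by rewrite xy.
Qed.

Lemma vanishes_variation a b nu (A : set mR) : vanishes_outside a b nu -> measurable A ->
  A `&` `]a, b[ = set0 -> variation_measure nu A = 0%E.
Proof.
move=> nu0 mA A0; apply: variation_measure_eq0 => // B mB BA.
by apply: nu0 => //; apply/seteqP; split => // z [/BA Az zab]; rewrite -A0.
Qed.

Lemma variation_right b nu x (e : R) : 0 < e -> x < b ->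
  exists2 d : R, x < d < b & forall y, x <= y -> y < d ->
    fine (variation_measure nu `]x, y]%classic) < e.
Proof.
move=> e0 xb.
have [d d0 hd] := finite_measure_right x (variation_measureT_lty nu) e0.
exists (Num.min (x + d) ((x + b) / 2)).
  rewrite lt_min gt_min ltrDl d0/= midf_lt// orbC.
  by rewrite (midf_lt xb).
move=> y xy; rewrite lt_min => /andP[yd _]; apply: le_lt_trans hd.
rewrite fine_le// ?variation_measure_fin//; try exact: measurable_itv.
rewrite le_measure ?inE//; try exact: measurable_itv.
by move=> z /=; rewrite !in_itv/= => /andP[-> /le_trans]; apply; exact: ltW.
Qed.

(** The intervals []y, b]] shrink to the point [b] and not to the empty set; the bound survives
    because [b] lies outside []a, b[] and carries no mass. *)
Lemma variation_left a b nu (e : R) : a < b -> vanishes_outside a b nu -> 0 < e ->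
  exists2 d : R, a < d < b & forall y, d < y -> y <= b ->
    fine (variation_measure nu `]y, b]%classic) < e.
Proof.
move=> ab nu0 e0.
have [d d0 hd] := finite_measure_left b (variation_measureT_lty nu) e0.
exists (Num.max (b - d) ((a + b) / 2)).
  by rewrite gt_max lt_max ltrBlDr ltrDl d0/= !midf_lt// orbT.
move=> y; rewrite gt_max => /andP[dy _] yb; apply: le_lt_trans hd.
have mb : measurable ([set b] : set mR) by exact: measurable_set1.
have my : measurable (`]y, b[%classic : set mR) by exact: measurable_itv.
rewrite fine_le// ?variation_measure_fin//; try exact: measurable_itv.
apply: (@le_trans _ _ (variation_measure nu (`]y, b[%classic `|` [set b]))).
  apply: le_measure; rewrite ?inE//; first exact: measurableU.
  move=> z /=; rewrite !in_itv/= le_eqVlt => /andP[yz /orP[/eqP ->|zb]]; first by right.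
  by left; rewrite yz.
rewrite measureU//; last first.
  by apply/seteqP; split => // z /= [+ zb]; rewrite in_itv/= zb ltxx andbF.
rewrite [X in (_ + X <= _)%E](_ : _ = 0%E); last first.
  apply: (vanishes_variation nu0) => //.
  by apply/seteqP; split => // z /= [->]; rewrite in_itv/= ltxx andbF.
rewrite adde0 le_measure ?inE//.
by move=> z /=; rewrite !in_itv/= => /andP[yz ->]; rewrite (lt_trans dy).
Qed.

Lemma primitive_ge_b a b nu x : a < b -> vanishes_outside a b nu -> b <= x ->
  primitive a nu x = primitive a nu b.
Proof.
move=> ab nu0 bx; apply/eqP; rewrite -subr_eq0 primitiveB ?(ltW ab)//.
rewrite nu0//.
apply/seteqP; split => // z /=; rewrite !in_itv/= => -[/andP[bz _] /andP[_]].
by rewrite ltNge ltW.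
Qed.

Lemma vanishes_primitiveB a b nu x y : vanishes_outside a b nu -> x <= y ->
  primitive a nu y - primitive a nu x = fine (nu `]x, y]%classic).
Proof.
move=> nu0 xy; have [ax|xa] := leP a x; first exact: primitiveB.
have moc s t : measurable (`]s, t]%classic : set mR) by exact: measurable_itv.
have out s t : t <= a -> nu `]s, t]%classic = 0%E.
  move=> ta; apply: nu0 => //; apply/seteqP; split => // z /=.
  by rewrite !in_itv/= => -[/andP[_ zt] /andP[az _]]; move: az; rewrite ltNge (le_trans zt).
have [ya|ay] := leP y a; first by rewrite out// !primitive_le ?subrr// ltW.
rewrite (primitive_le nu (ltW xa)) subr0.
have -> : `]x, y]%classic = `]x, a]%classic `|` `]a, y]%classic :> set mR.
  apply/seteqP; split => z /=; rewrite !in_itv/=.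
    by move=> /andP[-> ->]; rewrite andbT; case: (leP z a) => _; [left|right].
  by move=> [/andP[-> zx]|/andP[xz ->]]; rewrite ?(le_trans zx (ltW ay)) ?(lt_trans xa xz).
rewrite chargeU//; first by rewrite out// add0e.
apply/seteqP; split => // z /=; rewrite !in_itv/= => -[/andP[_ zx] /andP[xz _]].
by move: xz; rewrite ltNge zx.
Qed.

(** Right continuity upgrades equality almost everywhere to equality at each point of [[a, b[]. At
    [a] both primitives vanish, hence [c1 = c2]; at [b] they agree as limits from the left, since
    [b] carries no mass. The charges therefore agree on all half-open intervals. *)
Lemma primitive_unique a b c1 c2 nu1 nu2 : a < b ->
    vanishes_outside a b nu1 -> vanishes_outside a b nu2 ->
    {ae leb, forall x, `]a, b[%classic x ->
       c1 + primitive a nu1 x = c2 + primitive a nu2 x} ->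
  forall A, measurable A -> nu1 A = nu2 A.
Proof.
move=> ab nu10 nu20 aeE.
pose D x := (c1 + primitive a nu1 x) - (c2 + primitive a nu2 x).
have D0 x : a <= x -> x < b -> D x = 0.
  move=> ax xb; apply: contrapT => /eqP; rewrite -normr_gt0 => Dx0.
  have e0 : 0 < `|D x| / 2 by rewrite divr_gt0.
  have [d1 /andP[xd1 d1b] h1] := variation_right nu1 e0 xb.
  have [d2 /andP[xd2 d2b] h2] := variation_right nu2 e0 xb.
  have [||z /andP[xz]] := @ae_itv_exists _ _ _ x (Num.min d1 d2) aeE ax.
  - by rewrite lt_min xd1.
  - by rewrite ge_min (ltW d1b).
  rewrite lt_min => /andP[zd1 zd2] Ez.
  have := h1 _ (ltW xz) zd1; have := h2 _ (ltW xz) zd2.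
  have := le_norm_primitiveB nu1 ax (ltW xz); have := le_norm_primitiveB nu2 ax (ltW xz).
  have : `|D x| <= `|primitive a nu1 z - primitive a nu1 x| + `|primitive a nu2 z - primitive a nu2 x|.
    have -> : D x = (primitive a nu2 z - primitive a nu2 x) - (primitive a nu1 z - primitive a nu1 x).
      rewrite /D; lra.
    by rewrite [leRHS]addrC ler_normB.
  lra.
have pE x : a <= x -> x < b -> primitive a nu1 x = primitive a nu2 x.
  move=> ax xb; have := D0 _ ax xb; have := D0 _ (lexx a) ab.
  rewrite /D !(primitive_le _ (lexx a)); lra.
have pEb : primitive a nu1 b = primitive a nu2 b.
  apply/eqP; rewrite -subr_eq0; apply: contrapT => /negP; rewrite -normr_gt0.
  pose e := `|primitive a nu1 b - primitive a nu2 b|; rewrite -/e => e0.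
  have e20 : 0 < e / 2 by rewrite divr_gt0.
  have [d1 /andP[ad1 d1b] h1] := variation_left ab nu10 e20.
  have [d2 /andP[ad2 d2b] h2] := variation_left ab nu20 e20.
  pose z := (Num.max d1 d2 + b) / 2.
  have mb : Num.max d1 d2 < b by rewrite gt_max d1b.
  have zb : z < b by rewrite midf_lt.
  have : Num.max d1 d2 < z by rewrite midf_lt.
  rewrite gt_max => /andP[d1z d2z].
  have az : a <= z by rewrite ltW// (lt_trans ad1).
  have := h1 _ d1z (ltW zb); have := h2 _ d2z (ltW zb).
  have := le_norm_primitiveB nu1 az (ltW zb); have := le_norm_primitiveB nu2 az (ltW zb).
  have : e <= `|primitive a nu1 b - primitive a nu1 z| + `|primitive a nu2 b - primitive a nu2 z|.
    apply: le_trans (ler_normB _ _); rewrite /e (pE _ az zb).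
    by rewrite opprB addrA subrK.
  lra.
have pE' x : primitive a nu1 x = primitive a nu2 x.
  have [ax|xa] := leP a x; last by rewrite !primitive_le// ltW.
  have [xb|bx] := ltP x b; first exact: pE.
  by rewrite !(primitive_ge_b ab _ bx).
have moc x y : measurable (`]x, y]%classic : set mR) by exact: measurable_itv.
have nuE x y : nu1 `]x, y]%classic = nu2 `]x, y]%classic.
  have [yx|xy] := leP y x; first by rewrite set_itv_ge ?charge0// bnd_simp -leNgt.
  rewrite -[LHS]fineK; last exact: fin_num_measure.
  rewrite -(vanishes_primitiveB nu10 (ltW xy)) !pE' (vanishes_primitiveB nu20 (ltW xy)).
  by rewrite fineK//; exact: fin_num_measure.
(* The uniqueness theorem concerns nonnegative measures, so the negative parts are moved across the
   equality of the two charges. *)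
pose m1 : {measure set mR -> \bar R} := measure_add (pos_part nu1) (neg_part nu2).
pose m2 : {measure set mR -> \bar R} := measure_add (pos_part nu2) (neg_part nu1).
have m1E A : (m1 A = pos_part nu1 A + neg_part nu2 A)%E by exact: measure_addE.
have m2E A : (m2 A = pos_part nu2 A + neg_part nu1 A)%E by exact: measure_addE.
have mE A : measurable A -> m1 A = m2 A.
  apply: measure_eq_ocitv => x y; rewrite !m1E ?m2E.
    have := nuE x y; rewrite !charge_jordanE//.
    have := pos_part_fin nu1 (moc x y); have := pos_part_fin nu2 (moc x y).
    have := neg_part_fin nu1 (moc x y); have := neg_part_fin nu2 (moc x y).
    case: (pos_part nu1 _) (neg_part nu1 _) (pos_part nu2 _) (neg_part nu2 _) =>
      [p1||] [n1||] [p2||] [n2||]//= _ _ _ _ [E].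
    rewrite -?EFinD; congr EFin; lra.
  by rewrite ltey_eq fin_numD pos_part_fin ?neg_part_fin.
move=> A mA; have := mE A mA; rewrite !m1E ?m2E !charge_jordanE//.
have := pos_part_fin nu1 mA; have := pos_part_fin nu2 mA.
have := neg_part_fin nu1 mA; have := neg_part_fin nu2 mA.
case: (pos_part nu1 _) (neg_part nu1 _) (pos_part nu2 _) (neg_part nu2 _) =>
  [p1||] [n1||] [p2||] [n2||]//= _ _ _ _ [E].
rewrite -?EFinD; congr EFin; lra.
Qed.

(** [distr_derivative] is picked by choice; uniqueness identifies it with [nu] on Borel sets, so a
    splitting of [nu] bounds the variation of its primitive. *)
Lemma total_var_primitive_le a b c nu (m1 m2 : {measure set mR -> \bar R}) : a < b ->
    vanishes_outside a b nu ->
    (forall A, measurable A -> nu A + m2 A = m1 A)%E ->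
  forall A, measurable A ->
    (total_var_measure a b (fun x => c + primitive a nu x)%R A <= m1 A + m2 A)%E.
Proof.
move=> ab nu0 num A mA; apply: variation_measure_le => // B mB.
rewrite -num//; congr (_ + _)%E.
have hBV := BV_primitive c ab nu0.
have dd := distr_derivativeP hBV.
have [c' hc'] := BV_primitiveP ab hBV.1 dd.
by apply/esym; exact: (primitive_unique ab nu0 dd.1 hc').
Qed.

End uniqueness.

(** * First variation *)

Section euler_lagrange.
Context (R : realType).
Local Notation leb := (@lebesgue_measure R).
Local Notation mR := (measurableTypeR R).
Implicit Types (a b c x y : R) (nu : {charge set mR -> \bar R}) (alpha f u v : R -> R).

Lemma total_var_measure_fin a b u (A : set mR) : measurable A ->
  total_var_measure a b u A \is a fin_num.
Proof. exact: variation_measure_fin. Qed.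

(** Domination set by set passes to the integral of any nonnegative weight. The weighted term of [u]
    is finite, because [alpha] is bounded on [[a, b]], and so it can be cancelled. *)
Lemma argmin_fidelity_le a b alpha f u v :
    {within `[a, b], continuous alpha} ->
    (forall x : R, a <= x <= b -> 0 <= alpha x) ->
    is_argmin_BV a b (weighted_TV_energy a b alpha f) u -> BV a b v ->
    (forall A : set mR, measurable A -> (total_var_measure a b v A <= total_var_measure a b u A)%E) ->
  (\int[leb]_(x in `]a, b[) ((f x - u x) ^+ 2)%:E <=
   \int[leb]_(x in `]a, b[) ((f x - v x) ^+ 2)%:E)%E.
Proof.
move=> ca a0 [_ umin] BVv vu.
have mD : measurable (`]a, b[%classic : set mR) by exact: measurable_itv.
have ma : measurable_fun (`]a, b[%classic : set mR) alpha.
  apply: (@measurable_funS _ _ _ _ (`[a, b]%classic : set mR)) => //.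
    exact: subset_itv_oo_cc.
  apply: subspace_continuous_measurable_fun => //.
pose I w := (\int[total_var_measure a b w]_(x in `]a, b[) (alpha x)%:E)%E.
have IE w : I w = (\int[total_var_measure a b w]_(x in `]a, b[) ((alpha \_ `]a, b[) x)%:E)%E.
  by apply: eq_integral => x xD; rewrite /patch xD.
have ma' : measurable_fun [set: mR] (alpha \_ `]a, b[).
  by apply/(measurable_restrictT _ mD).
have a0' x : 0 <= (alpha \_ `]a, b[) x.
  rewrite /patch; case: ifPn => //; rewrite inE/= in_itv/= => /andP[/ltW ax /ltW xb].
  by rewrite a0// ax.
have Ivu : (I v <= I u)%E.
  rewrite !IE; apply: ge0_le_measure_integral => //.
  exact/measurable_EFinP.
have Ifin : I u \is a fin_num.
  have [M hM] := continuous_itv_bounded ca.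
  apply: integrable_fin_num => //.
  apply: measurable_bounded_integrable => //.
    by rewrite ltey_eq total_var_measure_fin.
  exists M; split; first by rewrite num_real.
  move=> N MN x /=; rewrite in_itv/= => /andP[/ltW ax /ltW xb].
  by apply: le_trans (ltW MN); apply: hM; rewrite ax.
have := umin v BVv; rewrite /weighted_TV_energy -/(I u) -/(I v).
move=> /le_trans /(_ (leeD2l _ Ivu)).
rewrite leeD2rE// lee_pmul2l//.
Qed.

(** The measure of density 1 - t 1_S with respect to [m]: [m] itself off [S], and (1 - t) [m] on
    [S]. *)
Lemma damped_measure d (T : measurableType d) (m : {measure set T -> \bar R})
    (S : set T) (t : R) : measurable S -> (m [set: T] < +oo)%E -> 0 <= t <= 1 ->
  exists m' : {measure set T -> \bar R}, forall A, measurable A ->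
    m' A = (fine (m A) - t * fine (m (A `&` S)))%:E.
Proof.
move=> mS mfin /andP[t0 t1]; have t1' : 0 <= 1 - t by rewrite subr_ge0.
exists (measure_add (mrestr m (measurableC mS)) (mscale (NngNum t1') (mrestr m mS))).
move=> A mA; rewrite [LHS]measure_addE/= /mscale/= /mrestr.
have fin B : measurable B -> m B \is a fin_num.
  move=> mB; rewrite ge0_fin_numE//; apply: le_lt_trans mfin.
  by apply: le_measure; rewrite ?inE.
have mAS : measurable (A `&` S) by exact: measurableI.
have mASC : measurable (A `&` ~` S) by apply: measurableI => //; exact: measurableC.
have E : m A = (m (A `&` ~` S) + m (A `&` S))%E.
  rewrite -measureU//; last by rewrite setIACA setICl setI0.
  by rewrite -setIUr setUCl setIT.
rewrite E -[X in (X + _)%E = _]fineK ?fin// -[X in (_ * X)%E]fineK ?fin//.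
rewrite fineD ?fin// -EFinM -EFinD; congr EFin; ring.
Qed.

(** Divide by [t] and let it tend to 0. Only [t <= 1] is on offer, since damping by 1 - t has to
    leave a nonnegative measure. *)
Lemma ler0_quadratic (A B : R) :
  (forall t, 0 < t -> t <= 1 -> 0 <= - (2 * t * A) + t ^+ 2 * B) -> A <= 0.
Proof.
move=> h; rewrite leNgt; apply/negP => A0.
have B0 : 0 <= `|B| by [].
(* Chosen so that [t * B <= A], which makes [t * B - 2 * A] negative when [A] is positive. *)
pose t := Num.min 1 (A / (1 + `|B|)).
have t0 : 0 < t by rewrite lt_min ltr01/= divr_gt0// ltr_wpDr.
have t1 : t <= 1 by rewrite ge_min lexx.
have tB : t * (1 + `|B|) <= A.
  by rewrite -ler_pdivlMr ?ltr_wpDr// ge_min lexx orbT.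
have := h t t0 t1; rewrite (_ : _ + _ = t * (t * B - 2 * A)); last by ring.
rewrite pmulr_rge0//.
have : t * B <= t * `|B| by rewrite ler_wpM2l ?ler_norm// ltW.
move: tB; rewrite mulrDr mulr1; lra.
Qed.

Section first_variation.
Variables (a b cu M : R) (alpha f F u : R -> R).
Hypothesis ab : a < b.
Hypothesis ca : {within `[a, b], continuous alpha}.
Hypothesis a0 : forall x : R, a <= x <= b -> 0 <= alpha x.
Hypothesis umin : is_argmin_BV a b (weighted_TV_energy a b alpha f) u.
Let nu := distr_derivative a b u.
Hypothesis mf : measurable_fun (`]a, b[%classic : set mR) f.
Hypothesis mF : measurable_fun (`]a, b[%classic : set mR) F.
Hypothesis FM : forall x, `|F x| <= M.
Hypothesis fF : {ae leb, forall x, `]a, b[%classic x -> f x = F x}.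
Let U x := cu + primitive a nu x.
Hypothesis uU : {ae leb, forall x, `]a, b[%classic x -> u x = U x}.

(** The derivative at [t = 0] of the fidelity term in the direction [k - w], up to a positive
    factor. [U] and [F] replace [u] and [f] because they are bounded at every point, which makes all
    products in the expanded square integrable. *)
Lemma first_variation k (S : set mR) (mS : measurable S) :
  0 <= \int[leb]_(x in `]a, b[) ((U x - F x) * (k - primitive a (crestr0 nu mS) x)).
Proof.
have mD : measurable (`]a, b[%classic : set mR) by exact: measurable_itv.
have nu0 : vanishes_outside a b nu by have [] := distr_derivativeP umin.1.
pose W x := k - primitive a (crestr0 nu mS) x.
have mW : measurable_fun (`]a, b[%classic : set mR) W.
  apply: measurable_funB => //; exact: measurable_primitive.
have mU : measurable_fun (`]a, b[%classic : set mR) U.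
  apply: measurable_funD => //; exact: measurable_primitive.
have [KW hW] : exists K, forall x, `|W x| <= K.
  exists (`|k| + fine (variation_measure (crestr0 nu mS) setT)) => x.
  by rewrite (le_trans (ler_normB _ _))// lerD2l primitive_bounded.
have [KU hU] : exists K, forall x, `|F x - U x| <= K.
  exists (M + (`|cu| + fine (variation_measure nu setT))) => x.
  rewrite (le_trans (ler_normB _ _))// lerD//.
  by rewrite (le_trans (ler_normD _ _))// lerD2l primitive_bounded.
have mFU : measurable_fun (`]a, b[%classic : set mR) (fun x => F x - U x).
  exact: measurable_funB.
have prod_int (g h : R -> R) K L : measurable_fun (`]a, b[%classic : set mR) g ->
    measurable_fun (`]a, b[%classic : set mR) h ->
    (forall x, `|g x| <= K) -> (forall x, `|h x| <= L) ->
    leb.-integrable `]a, b[ (EFin \o (fun x => g x * h x)).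
  move=> mg mh gK hL; apply: (integrable_itv_bounded (M := K * L)).
    exact: measurable_funM.
  by move=> x _; rewrite normrM ler_pM.
suff : \int[leb]_(x in `]a, b[) ((F x - U x) * W x) <= 0.
  rewrite -oppr_ge0 -mulN1r -RintegralZl//; last exact: prod_int hU hW.
  move=> h; apply: le_trans h _; rewrite le_eqVlt; apply/orP; left; apply/eqP.
  by apply: eq_Rintegral => x _; rewrite /W; ring.
apply: (@ler0_quadratic _ (\int[leb]_(x in `]a, b[) (W x * W x))) => t t0 t1.
have t01 : 0 <= t <= 1 by rewrite ltW.
pose lam : {charge set mR -> \bar R} := cadd nu (cscale (- t) (crestr0 nu mS)).
pose v x := (cu + t * k) + primitive a lam x.
have vE x : v x = U x + t * W x.
  rewrite /v /U /W /primitive /cadd/= /cscale/=.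
  have moc : measurable (`]a, x]%classic : set mR) by exact: measurable_itv.
  have fn1 : nu `]a, x]%classic \is a fin_num by exact: fin_num_measure.
  have fn2 : crestr0 nu mS `]a, x]%classic \is a fin_num by exact: fin_num_measure.
  by rewrite fineD ?fin_numM// fineM//=; ring.
have lamE A : measurable A -> lam A =
    (nu A + (- t)%:E * nu (A `&` S))%E.
  move=> mA; rewrite -[LHS]/(nu A + (- t)%:E * crestr0 nu mS A)%E.
  by rewrite /crestr0 mem_set.
have lam0 : vanishes_outside a b lam.
  move=> A mA A0; rewrite lamE//.
  rewrite !nu0 ?mule0 ?adde0//; first exact: measurableI.
  by rewrite setIAC A0 set0I.
have BVv : BV a b v.
  exact: BV_primitive.
have vu A : measurable A -> (total_var_measure a b v A <= total_var_measure a b u A)%E.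
  (* Damping the two Jordan parts separately writes [lam] as a difference of measures whose sum has
     density 1 - t 1_S with respect to the variation of [nu], hence is at most that variation. *)
  have [m1 m1E] := damped_measure mS (pos_partT_lty nu) t01.
  have [m2 m2E] := damped_measure mS (neg_partT_lty nu) t01.
  move=> mA.
  apply: (le_trans (total_var_primitive_le (cu + t * k) (m1 := m1) (m2 := m2) ab lam0 _ mA)).
    move=> B mB; have mBS : measurable (B `&` S) by exact: measurableI.
    rewrite lamE// m1E// m2E//.
    rewrite !charge_jordanE//.
    have := pos_part_fin nu mB; have := pos_part_fin nu mBS.
    have := neg_part_fin nu mB; have := neg_part_fin nu mBS.
    case: (pos_part nu B) (neg_part nu B) (pos_part nu _) (neg_part nu _) =>
      [p||] [n||] [pS||] [nS||]//= _ _ _ _.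
    by rewrite -?(EFinD, EFinM); congr EFin; ring.
  have mAS : measurable (A `&` S) by exact: measurableI.
  rewrite m1E// m2E// /total_var_measure variation_jordanE -/nu.
  rewrite -[X in (_ <= X + _)%E]fineK ?pos_part_fin//.
  rewrite -[X in (_ <= _ + X)%E]fineK ?neg_part_fin//.
  rewrite -!EFinD lee_fin.
  have : 0 <= t * fine (pos_part nu (A `&` S)) by apply: mulr_ge0; [exact: ltW|exact: fine_ge0].
  have : 0 <= t * fine (neg_part nu (A `&` S)) by apply: mulr_ge0; [exact: ltW|exact: fine_ge0].
  lra.
have := argmin_fidelity_le ca a0 umin BVv vu.
have mu : measurable_fun (`]a, b[%classic : set mR) u.
  by apply/measurable_EFinP; exact: (measurable_int leb umin.1.1).
have mv : measurable_fun (`]a, b[%classic : set mR) v.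
  by apply/measurable_EFinP; exact: (measurable_int leb BVv.1).
have -> : (\int[leb]_(x in `]a, b[) ((f x - u x) ^+ 2)%:E =
          \int[leb]_(x in `]a, b[) ((F x - U x) * (F x - U x))%:E)%E.
  apply: ae_eq_integral => //.
  - by apply/measurable_EFinP/measurable_funX/measurable_funB.
  - by apply/measurable_EFinP/measurable_funM.
  - move: fF uU; apply: filterS2; first exact: (ae_filter_ringOfSetsType leb).
    by move=> x /= fFx uUx xD; rewrite fFx// uUx// expr2.
have -> : (\int[leb]_(x in `]a, b[) ((f x - v x) ^+ 2)%:E =
          \int[leb]_(x in `]a, b[) ((F x - U x) * (F x - U x) +
            (- (2 * t) * ((F x - U x) * W x) + t ^+ 2 * (W x * W x)))%:E)%E.
  apply: ae_eq_integral => //.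
  - by apply/measurable_EFinP/measurable_funX/measurable_funB.
  - apply/measurable_EFinP/measurable_funD; first exact: measurable_funM.
    by apply: measurable_funD; apply: measurable_funM => //; exact: measurable_funM.
  - move: fF; apply: filterS; first exact: (ae_filter_ringOfSetsType leb).
    move=> x /= fFx xD; congr EFin; rewrite fFx// vE; ring.
have iFF := prod_int _ _ _ _ mFU mFU hU hU.
have iFW := prod_int _ _ _ _ mFU mW hU hW.
have iWW := prod_int _ _ _ _ mW mW hW hW.
have iA := @integrableZl _ _ _ leb _ mD (- (2 * t)) _ iFW.
have iB := @integrableZl _ _ _ leb _ mD (t ^+ 2) _ iWW.
have iAB := integrableD mD iA iB.
have iAll := integrableD mD iFF iAB.
move=> /(fine_le (integrable_fin_num mD iFF) (integrable_fin_num mD iAll)).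
rewrite -!/(Rintegral _ _ _) (RintegralD mD iFF iAB) (RintegralD mD iA iB).
rewrite (RintegralZl _ mD iFW) (RintegralZl _ mD iWW) lerDl.
by rewrite mulNr.
Qed.

End first_variation.

End euler_lagrange.

(** * The potential of u - f and its sign *)

Section potential.
Context (R : realType).
Local Notation leb := (@lebesgue_measure R).
Local Notation mR := (measurableTypeR R).
Variables (a b K : R) (h : R -> R).
Hypothesis mh : measurable_fun (`]a, b[%classic : set mR) h.
Hypothesis hK : forall x, `|h x| <= K.

(** An antiderivative of [h] normalised at [b]: its opposite is exactly the inner integral that
    [fubini_primitive] produces, so testing [h] against a primitive amounts to integrating the
    potential. *)
Definition potential y : R := - \int[leb]_(x in `[y, b[) h x.

Let ih : leb.-integrable `]a, b[ (EFin \o h).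
Proof. exact: (integrable_itv_bounded (M := K)). Qed.

Let ih' : leb.-integrable `[a, b[ (EFin \o h).
Proof.
have [ab|ba] := ltP a b; last first.
  rewrite (_ : `[a, b[%classic = set0); first exact: integrable_set0.
  by apply/seteqP; split => // z /=; rewrite in_itv/= => /andP[az /(le_lt_trans az)]; rewrite ltNge ba.
apply/integrableP; split.
  have mab : measurable (`]a, b[%classic : set mR) by exact: measurable_itv.
  have -> : `[a, b[%classic = [set a] `|` `]a, b[%classic :> set mR.
    apply/seteqP; split => z /=; rewrite !in_itv/=.
      by rewrite le_eqVlt => /andP[/orP[/eqP ->|->] ->]; [left|right].
    by move=> [->|/andP[/ltW -> ->]//]; rewrite lexx.
  apply/measurable_funU => //; split; first exact: measurable_fun_set1.
  exact: (measurable_int leb ih).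
rewrite -integral_itv_obnd_cbnd; last first.
  by apply: measurableT_comp => //; exact: (measurable_int leb ih).
by move/integrableP : ih => [].
Qed.

Lemma potential_end : potential b = 0.
Proof.
rewrite /potential (_ : `[b, b[%classic = set0) ?Rintegral_set0 ?oppr0//.
by apply/seteqP; split => // z /=; rewrite in_itv/= => /andP[/le_lt_trans + /[dup] zb] => /(_ _ zb); rewrite ltxx.
Qed.

Lemma potentialB x y : a <= x -> x <= y -> y <= b ->
  potential y - potential x = \int[leb]_(z in `]x, y[) h z.
Proof.
move=> ax xy yb; rewrite /potential opprK addrC.
have -> : `[x, b[%classic = `[x, y[ `|` `[y, b[ :> set mR.
  apply/seteqP; split => z /=; rewrite !in_itv/=.
    by move=> /andP[-> ->]; rewrite andbT; case: (ltP z y) => _; [left|right].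
  by move=> [/andP[-> zx]|/andP[xz ->]]; rewrite ?(lt_le_trans zx yb) ?(le_trans xy xz).
rewrite Rintegral_setU//.
- rewrite addrK Rintegral_itv_obnd_cbnd//.
  by apply: integrableS ih => //; exact: subset_itvW.
- apply: integrableS ih' => //; first exact: measurableU.
  move=> z /=; rewrite !in_itv/= => -[/andP[xz zy]|/andP[yz ->]].
    by rewrite (le_trans ax xz) (lt_le_trans zy yb).
  by rewrite (le_trans ax (le_trans xy yz)).
- apply/disj_setPS => z /=; rewrite !in_itv/= => -[/andP[_ zy] /andP[yz _]].
  by move: zy; rewrite ltNge yz.
Qed.

Lemma potential_ge c x y : a <= x -> x <= y -> y <= b ->
  (forall z, x < z < y -> c <= h z) -> c * (y - x) <= potential y - potential x.
Proof.
move=> ax xy yb ch; rewrite potentialB// -integral_itv_cst//.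
have ihxy : leb.-integrable `]x, y[ (EFin \o h).
  by apply: integrableS ih => //; exact: subset_itvW.
apply: (le_Rintegral _ (integrable_itv_cst c x y) ihxy _) => //.
Qed.

Lemma potential_le c x y : a <= x -> x <= y -> y <= b ->
  (forall z, x < z < y -> h z <= c) -> potential y - potential x <= c * (y - x).
Proof.
move=> ax xy yb ch; rewrite potentialB// -integral_itv_cst//.
have ihxy : leb.-integrable `]x, y[ (EFin \o h).
  by apply: integrableS ih => //; exact: subset_itvW.
apply: (le_Rintegral _ ihxy (integrable_itv_cst c x y) _) => //.
Qed.

Lemma potential_lipschitz x y : a <= x -> x <= y -> y <= b ->
  `|potential y - potential x| <= K * (y - x).
Proof.
move=> ax xy yb; rewrite ler_norml -mulNr; apply/andP; split.
  apply: potential_ge => // z _.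
  by have := hK z; rewrite ler_norml => /andP[].
apply: potential_le => // z _.
by have := hK z; rewrite ler_norml => /andP[].
Qed.

Lemma measurable_potential : measurable_fun (`]a, b[%classic : set mR) potential.
Proof.
apply: open_continuous_measurable_fun; first exact: interval_open.
move=> x; rewrite inE/= in_itv/= => /andP[ax xb].
have K0 : 0 <= K by exact: le_trans (hK x).
have K1 : 0 < K + 1 by rewrite ltr_wpDl.
apply/cvgrPdist_lt => e e0; near=> y.
have ay : a < y by near: y; exact: lt_nbhsr.
have yb : y < b by near: y; exact: lt_nbhsl.
have : `|potential x - potential y| <= K * `|x - y|.
  have [xy|yx] := leP x y.
    by rewrite distrC [`|x - y|]distrC [`|y - x|]ger0_norm ?subr_ge0// potential_lipschitz// ltW.
  by rewrite [`|x - y|]gtr0_norm ?subr_gt0// potential_lipschitz// ltW.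
move=> /le_lt_trans; apply.
apply: (@le_lt_trans _ _ ((K + 1) * `|x - y|)).
  by rewrite ler_wpM2r// lerDl.
rewrite -ltr_pdivlMl//; near: y.
by apply: (@cvgr_dist_lt _ _ _ _ _ id) => //; rewrite mulr_gt0 ?invr_gt0.
Unshelve. all: by end_near. Qed.

End potential.

(** The integral of [g] against [m] restricted to [S] is both nonpositive, by hypothesis, and
    nonnegative, so [g] vanishes almost everywhere for that measure; yet it vanishes nowhere on
    [S]. *)
Lemma mrestr_integralN_ge0 (R : realType) d (T : measurableType d)
    (m : {measure set T -> \bar R}) (D S : set T) (mS : measurable S) (g : T -> R) (M : R) :
    (m [set: T] < +oo)%E -> measurable D -> S `<=` D -> measurable_fun D g ->
    (forall x, D x -> `|g x| <= M) -> (forall x, S x -> 0 < g x) ->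
    0 <= \int[mrestr m mS]_(x in D) (- g x) ->
  m S = 0%E.
Proof.
move=> mfin mD SD mg gM g0 Ng_ge0.
pose r : {measure set T -> \bar R} := mrestr m mS.
have rfin : (r D < +oo)%E.
  by apply: le_lt_trans mfin; apply: le_measure; rewrite ?inE//; exact: measurableI.
have ig : r.-integrable D (EFin \o g).
  apply: measurable_bounded_integrable => //.
  by exists M; split; [rewrite num_real|move=> N MN x Dx; exact: le_trans (gM x Dx) (ltW MN)].
have g_le0 : \int[r]_(x in D) g x <= 0.
  rewrite -oppr_ge0 -mulN1r -RintegralZl//.
  by under eq_Rintegral do rewrite mulN1r.
have mgS : measurable_fun D (EFin \o (g \_ S)).
  apply/measurable_EFinP/(measurable_restrict _ mS mD).
  by apply: measurable_funS mg.
(* Outside [S] the sign of [g] is unknown, but the restricted measure does not charge [D] minus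
   [S]. *)
have E : (\int[r]_(x in D) (g x)%:E = \int[r]_(x in D) `|(EFin \o (g \_ S)) x|)%E.
  apply: ae_eq_integral => //.
  - exact: (measurable_int r).
  - exact: measurableT_comp.
  - exists (D `\` S); split; first exact: measurableD.
      by rewrite /r/= /mrestr setDE -setIA setICl setI0 measure0.
    move=> x /= Hx; apply: contrapT => DSx; apply: Hx => Dx.
    have Sx : S x by apply: contrapT => nSx; apply: DSx.
    by rewrite /= /patch mem_set// ger0_norm// ltW// g0.
have : (\int[r]_(x in D) `|(EFin \o (g \_ S)) x| = 0)%E.
  apply/eqP; rewrite eq_le integral_ge0// andbT -E -[leLHS]fineK ?lee_fin//.
  exact: integrable_fin_num.
move=> /(ae_eq_integral_abs r mD mgS)[A [mA A0 AP]].
have SA : S `<=` A.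
  move=> x Sx; apply: AP => /= /(_ (SD x Sx)); rewrite /patch mem_set// => -[gx0].
  by have := g0 x Sx; rewrite gx0 ltxx.
have : (r S <= r A)%E by apply: le_measure; rewrite ?inE.
by rewrite A0 measure_le0 /r/= /mrestr setIid => /eqP.
Qed.

Section excursion_null.
Context (R : realType).
Local Notation leb := (@lebesgue_measure R).
Local Notation mR := (measurableTypeR R).

Lemma potentialN (b : R) (h : R -> R) y : leb.-integrable `[y, b[ (EFin \o h) ->
  potential b (\- h) y = - potential b h y.
Proof.
move=> ih; rewrite /potential; congr (- _); rewrite -mulN1r -RintegralZl//.
by apply: eq_Rintegral => x _; rewrite mulN1r.
Qed.

(** Fubini turns the last hypothesis into nonnegativity of the integral of minus the potential
    against [m] restricted to [S], where the potential is positive. The bound [K * (b - a)] on the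
    potential comes from its Lipschitz constant and its zero at [b]. *)
Lemma excursion_null (a b K : R) (h : R -> R) (m : {measure set mR -> \bar R}) (S : set mR)
    (mS : measurable S) : (m [set: mR] < +oo)%E ->
    measurable_fun (`]a, b[%classic : set mR) h -> (forall x, `|h x| <= K) ->
    S `<=` `]a, b[%classic -> (forall x, S x -> 0 < potential b h x) ->
    0 <= \int[leb]_(x in `]a, b[) (h x * fine (mrestr m mS `]a, x]%classic)) ->
  m S = 0%E.
Proof.
move=> mfin mh hK SD vpos.
have rfin : (mrestr m mS setT < +oo)%E.
  by apply: le_lt_trans mfin; apply: le_measure; rewrite ?inE//; exact: measurableI.
have ih : leb.-integrable `]a, b[ (EFin \o h) by exact: (integrable_itv_bounded (M := K)).
rewrite (fubini_primitive rfin ih) => v_ge0.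
apply: (@mrestr_integralN_ge0 R _ mR m `]a, b[%classic S mS (potential b h) (K * (b - a))) => //.
- exact: (measurable_potential mh hK).
- move=> x /=; rewrite in_itv/= => /andP[ax xb].
  have := potential_lipschitz mh hK (ltW ax) (ltW xb) (lexx b).
  rewrite potential_end sub0r normrN => /le_trans; apply.
  by rewrite ler_wpM2l ?(le_trans _ (hK x))// lerD2l lerN2 ltW.
- by under eq_Rintegral do rewrite opprK.
Qed.

End excursion_null.

(** * Comparison of the variations of u and f *)

Section last_zero.
Context (R : realType).
Implicit Types (v : R -> R) (a b K x y : R).

Definition lipschitz_itv K a b v :=
  forall x y, a <= x -> x <= y -> y <= b -> `|v y - v x| <= K * (y - x).

(** [l] is the supremum of the points of [[a, x]] where [v <= 0]. The Lipschitz bound rules out both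
    signs there: a positive value would persist just before [l], a negative one just after. *)
Lemma lipschitz_last_zero K a x v : lipschitz_itv K a x v -> a <= x -> v a <= 0 -> 0 < v x ->
  exists l, [/\ a <= l, l < x, v l = 0 & forall z, l < z -> z <= x -> 0 < v z].
Proof.
move=> vK ax va vx.
(* A positive Lipschitz constant, by which one can divide. *)
pose K1 := `|K| + 1.
have K10 : 0 < K1 by rewrite ltr_wpDl.
have {}vK s t : a <= s -> s <= t -> t <= x -> `|v t - v s| <= K1 * (t - s).
  move=> as' st tx; apply: le_trans (vK _ _ as' st tx) _.
  by rewrite ler_wpM2r ?subr_ge0// (le_trans (ler_norm K))// lerDl.
pose E := [set z | a <= z <= x /\ v z <= 0].
have Ea : E a by rewrite /E/= lexx ax.
have supE : has_sup E.
  by split; [exists a|exists x => z [/andP[_ ->]]].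
pose l := sup E.
have al : a <= l by exact: ub_le_sup supE.2 _ Ea.
have lx : l <= x by apply: sup_le_ub; [exists a|move=> z [/andP[_ ->]]].
have vpos z : l < z -> z <= x -> 0 < v z.
  move=> lz zx; rewrite ltNge; apply/negP => vz.
  have : E z by rewrite /E/= zx (le_trans al (ltW lz)).
  by move=> /(ub_le_sup supE.2); rewrite leNgt lz.
have vl_le0 : v l <= 0.
  rewrite leNgt; apply/negP => vl0.
  have e0 : 0 < v l / K1 by rewrite divr_gt0.
  have [z Ez] := sup_adherent e0 supE; rewrite -/l => lz.
  have zl : z <= l by exact: ub_le_sup supE.2 _ Ez.
  have [/andP[az _] vz] := Ez.
  have := vK _ _ az zl lx.
  have : K1 * (l - z) < v l.
    by rewrite mulrC -ltr_pdivlMr// ltrBlDl -ltrBlDr.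
  have := ler_norm (v l - v z); lra.
have {}lx : l < x.
  by rewrite lt_neqAle lx andbT; apply/eqP => lxE; move: vx; rewrite -lxE ltNge vl_le0.
exists l; split => //.
apply/eqP; rewrite eq_le vl_le0/= leNgt; apply/negP => vl0.
have e0 : 0 < - v l / K1 by rewrite divr_gt0 ?oppr_gt0.
pose z := Num.min x (l + - v l / K1).
have lz : l < z by rewrite lt_min lx/= ltrDl.
have zx : z <= x by rewrite ge_min lexx.
have := vK _ _ al (ltW lz) zx.
have : K1 * (z - l) <= - v l.
  by rewrite mulrC -ler_pdivlMr// lerBlDl ge_min lexx orbT.
have := vpos z lz zx; have := ler_norm (v z - v l); lra.
Qed.

(** The reflection z -> -z exchanges first and last zeros. *)
Lemma lipschitz_first_zero K x b v : lipschitz_itv K x b v -> x <= b -> 0 < v x -> v b <= 0 ->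
  exists r, [/\ x < r, r <= b, v r = 0 & forall z, x <= z -> z < r -> 0 < v z].
Proof.
move=> vK xb vx vb.
have [||||l [bl lx vl vpos]] := @lipschitz_last_zero K (- b) (- x) (fun z => v (- z)).
- move=> s t bs st tx; rewrite distrC.
  have := vK (- t) (- s); rewrite opprK [- s + t]addrC; apply.
  + by rewrite lerNr.
  + by rewrite lerN2.
  + by rewrite lerNl.
- by rewrite lerN2.
- by rewrite opprK.
- by rewrite opprK.
exists (- l); split => //.
- by rewrite ltrNr.
- by rewrite lerNl.
- move=> z xz zl; have := vpos (- z); rewrite opprK; apply.
    by rewrite ltrNr.
  by rewrite lerN2.
Qed.

End last_zero.

Section variation_comparison.
Context (R : realType).
Variables (a b K : R).
Implicit Types (U F v V : R -> R) (x y l : R).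

(** All that the comparison retains of optimality, free of measures: v' = U - F in integrated form,
    monotonicity of [U] on the excursions of [v], and right continuity of [U - F]. The conditions
    are invariant under changing all three signs, so only excursions above 0 need an argument. *)
Definition monotone_coupling U F v :=
  [/\ forall c x y, a <= x -> x <= y -> y <= b ->
        (forall z, x < z < y -> c <= U z - F z) -> c * (y - x) <= v y - v x,
      forall c x y, a <= x -> x <= y -> y <= b ->
        (forall z, x < z < y -> U z - F z <= c) -> v y - v x <= c * (y - x),
      forall x y, a <= x -> x < y -> y < b ->
        (forall z, x < z -> z <= y -> 0 < v z) -> U x <= U y,
      forall x y, a <= x -> x < y -> y < b ->
        (forall z, x < z -> z <= y -> v z < 0) -> U y <= U x &
      forall x e, a <= x -> x < b -> 0 < e -> exists2 d, x < d < b &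
        forall z, x <= z -> z < d -> `|(U z - F z) - (U x - F x)| < e].

Lemma monotone_couplingN U F v :
  monotone_coupling U F v -> monotone_coupling (\- U) (\- F) (\- v).
Proof.
move=> [h1 h2 h3 h4 h5]; split.
- move=> c x y ax xy yb hc.
  have := h2 (- c) x y ax xy yb; rewrite mulNr => h.
  have : v y - v x <= - (c * (y - x)).
    by apply: h => z zxy; have := hc z zxy; rewrite /=; lra.
  rewrite /=; lra.
- move=> c x y ax xy yb hc.
  have := h1 (- c) x y ax xy yb; rewrite mulNr => h.
  have : - (c * (y - x)) <= v y - v x.
    by apply: h => z zxy; have := hc z zxy; rewrite /=; lra.
  rewrite /=; lra.
- move=> x y ax xy yb hv; rewrite /= lerN2; apply: h4 => // z xz zy.
  by have := hv z xz zy; rewrite /= oppr_gt0.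
- move=> x y ax xy yb hv; rewrite /= lerN2; apply: h3 => // z xz zy.
  by have := hv z xz zy; rewrite /= oppr_lt0.
- move=> x e ax xb e0; have [d xdb hd] := h5 x e ax xb e0; exists d => // z xz zd.
  rewrite /= [X in `|X|](_ : _ = - ((U z - F z) - (U x - F x))); last by ring.
  by rewrite normrN hd.
Qed.

(* On the excursion of [v] above 0 that starts at [l], the function [U] increases
   and stays above [F l]; [x'] witnesses that the excursion has begun. *)
Definition positive_excursion U F v x l :=
  F l <= U x /\ exists x', [/\ x <= x', l < x', x' < b & forall z, l < z -> z <= x' -> 0 < v z].

(** The alternatives are contact of [U] and [F] at [x], or an excursion of either sign. An excursion
    may have [l = x]: when [v x = 0] but [U x] and [F x] differ, it is only about to begin. *)
Definition last_contact U F v x l :=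
  [/\ a <= l, l <= x, v l = 0, forall z, l < z -> z <= x -> v z != 0 &
      [\/ l = x /\ U x = F x, positive_excursion U F v x l |
          positive_excursion (\- U) (\- F) (\- v) x l]].

Lemma last_contactN U F v x l : last_contact U F v x l -> last_contact (\- U) (\- F) (\- v) x l.
Proof.
have NN (g : R -> R) : \- (\- g) = g by apply/funext => z; rewrite /= opprK.
move=> [al lx vl nz c]; split => //.
- by rewrite /= vl oppr0.
- by move=> z lz zx; rewrite /= oppr_eq0 nz.
- by rewrite !NN; case: c => [[-> UF]|c|c]; [apply: Or31|apply: Or33|apply: Or32]; rewrite //= UF.
Qed.

(** If [U l < F l], right continuity would keep [U - F] negative just after [l], and [v] could not
    rise from 0. Hence [F l <= U l], and [U l <= U x] by monotonicity on the excursion. *)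
Lemma last_contact_pos U F v x : monotone_coupling U F v -> lipschitz_itv K a b v ->
  v a = 0 -> a <= x -> x < b -> 0 < v x -> exists l, last_contact U F v x l.
Proof.
move=> [h1 h2 h3 h4 h5] vK va ax xb vx.
have vKx : lipschitz_itv K a x v.
  by move=> s t as' st tx; apply: vK => //; exact: le_trans tx (ltW xb).
have [|l [al lx vl vpos]] := lipschitz_last_zero vKx ax _ vx; first by rewrite va.
exists l; split => //; first exact: ltW.
  by move=> z lz zx; rewrite gt_eqF// vpos.
have lb := lt_trans lx xb.
apply: Or32; split; last by exists x; split.
apply: (@le_trans _ _ (U l)); last first.
  by apply: h3.
rewrite leNgt; apply/negP => UF.
have e0 : 0 < F l - U l by rewrite subr_gt0.
have [d /andP[ld db] hd] := h5 l (F l - U l) al lb e0.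
pose y := Num.min d x.
have ly : l < y by rewrite lt_min ld.
have yx : y <= x by rewrite ge_min lexx orbT.
have yd : y <= d by rewrite ge_min lexx.
have := h2 0 l y al (ltW ly) (le_trans yx (ltW xb)).
rewrite mul0r vl subr0 => h; have : v y <= 0.
  apply: h => z /andP[lz zy]; have := hd z (ltW lz) (lt_le_trans zy yd).
  by have := ler_norm (U z - F z - (U l - F l)); lra.
by rewrite leNgt vpos.
Qed.

(** Right continuity keeps [U - F] above half its value at [x] for a while, so [v] grows at least
    linearly and an excursion starts at [x]. *)
Lemma last_contact_zero U F v x : monotone_coupling U F v ->
  a <= x -> x < b -> v x = 0 -> F x < U x -> last_contact U F v x x.
Proof.
move=> [h1 h2 h3 h4 h5] ax xb vx FU; split => //.
  by move=> z /lt_le_trans h /h; rewrite ltxx.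
apply: Or32; split; first exact: ltW.
have e0 : 0 < (U x - F x) / 2 by rewrite divr_gt0 ?subr_gt0.
have [d /andP[xd db] hd] := h5 x _ ax xb e0.
exists ((x + d) / 2); rewrite ?midf_le ?midf_lt ?(ltW xd)//; split => //.
- by rewrite (lt_trans _ db)// midf_lt.
- move=> y xy yxd; have yd : y < d by rewrite (le_lt_trans yxd)// midf_lt.
  have := h1 ((U x - F x) / 2) x y ax (ltW xy) (ltW (lt_trans yd db)).
  rewrite vx subr0 => h; apply: (@lt_le_trans _ _ ((U x - F x) / 2 * (y - x))).
    by rewrite mulr_gt0// subr_gt0.
  apply: h => z /andP[xz zy]; have := hd z (ltW xz) (lt_trans zy yd).
  by rewrite ltr_norml => /andP[+ _]; lra.
Qed.

Lemma opp_funK (g : R -> R) : \- (\- g) = g.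
Proof. by apply/funext => z; rewrite /= opprK. Qed.

Lemma lipschitz_itvN v : lipschitz_itv K a b v -> lipschitz_itv K a b (\- v).
Proof.
by move=> vK x y ax xy yb; rewrite /= -opprD normrN; exact: vK.
Qed.

Lemma last_contact_ex U F v x : monotone_coupling U F v -> lipschitz_itv K a b v ->
  v a = 0 -> a <= x -> x < b -> exists l, last_contact U F v x l.
Proof.
move=> mc vK va ax xb.
have mcN := monotone_couplingN mc.
have back l : last_contact (\- U) (\- F) (\- v) x l -> last_contact U F v x l.
  by move=> /last_contactN; rewrite !opp_funK.
have [vx|vx|vx] := ltgtP (v x) 0.
- have [||l /back] := last_contact_pos mcN (lipschitz_itvN vK) _ ax xb.
  + by rewrite /= va oppr0.
  + by rewrite /= oppr_gt0.
  + by exists l.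
- exact: last_contact_pos.
- exists x; have [UF|FU|UF] := ltgtP (U x) (F x).
  + by apply/back/last_contact_zero => //=; rewrite ?vx ?oppr0// ltrN2.
  + exact: last_contact_zero.
  + split => //; first by move=> z /lt_le_trans h /h; rewrite ltxx.
    exact: Or31.
Qed.

(* Before an excursion of [v] above 0 ends, [U] is caught up by [F]: otherwise
   [v' = U - F] would be positive until then and [v] could not come back to 0. *)
Lemma excursion_catch_up U F v x l e : monotone_coupling U F v -> lipschitz_itv K a b v ->
    a <= l -> l <= x -> positive_excursion U F v x l -> x < e -> e <= b -> v e = 0 ->
  exists z, [/\ x <= z, z < e & U x <= F z].
Proof.
move=> [h1 h2 h3 h4 h5] vK al lx [_ [x' [xx' lx' x'b vpos]]] xe eb ve.
have x'e : x' < e.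
  rewrite ltNge; apply/negP => ex'.
  by have := vpos e (le_lt_trans lx xe) ex'; rewrite ve ltxx.
have ax : a <= x by exact: le_trans lx.
have vKe : lipschitz_itv K x' e v.
  move=> s t xs st te; apply: vK => //; last exact: le_trans eb.
  by rewrite (le_trans (le_trans ax xx')).
(* The excursion may end before [e]; [U] is known to increase only up to its actual end [r]. *)
have [|r [x'r re vr vpos']] := lipschitz_first_zero vKe (ltW x'e) (vpos x' lx' (lexx _)).
  by rewrite ve.
have vposr z : x < z -> z < r -> 0 < v z.
  move=> xz zr; have [zx'|x'z] := leP z x'; first by rewrite vpos// (le_lt_trans lx).
  by rewrite vpos'// ltW.
apply: contrapT => nz.
have FU z : x <= z -> z < r -> F z < U z.
  move=> xz zr; apply: (@lt_le_trans _ _ (U x)).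
    rewrite ltNge; apply/negP => UF; apply: nz; exists z; split => //.
    exact: lt_le_trans re.
  move: xz; rewrite le_eqVlt => /predU1P[->//|xz].
  apply: h3 => //; first by rewrite (lt_le_trans zr)// (le_trans re).
  by move=> w xw wz; rewrite vposr// (le_lt_trans wz).
have := h1 0 x' r (le_trans ax xx') (ltW x'r) (le_trans re eb).
rewrite mul0r vr sub0r oppr_ge0 => h; have : v x' <= 0.
  apply: h => z /andP[x'z zr]; rewrite subr_ge0 ltW// FU//.
  by rewrite (le_trans xx')// ltW.
by rewrite leNgt vpos.
Qed.

Section comparison.
Variables (F V : R -> R) (M : R).
Hypothesis FV : forall x y, a <= x -> x <= y -> y < b -> `|F y - F x| <= V y - V x.

(** If [l' = l], both points lie on one excursion, [U] increases and the right side is exactly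
    [U y - U x]. Otherwise [x < l'], and [F] catches up with [U x] at some [z] before [l']: the
    variation of [F] from [l] to [z] pays for both [U x - F l] and [F z - U x], and its variation
    from [z] to [l'] for the rest of the way to [F l']. *)
Lemma last_contact_step_pos U v x y l l' :
    monotone_coupling U F v -> lipschitz_itv K a b v ->
    last_contact U F v x l -> positive_excursion U F v x l ->
    last_contact U F v y l' -> x < y -> y < b ->
  `|U y - U x| <= (V l' + `|U y - F l'|) - (V l + `|U x - F l|).
Proof.
move=> mc vK [al lx vl nz _] pe [al' l'y vl' nz' c'] xy yb.
have ll' : l <= l'.
  rewrite leNgt; apply/negP => l'l.
  by have := nz' l l'l (le_trans lx (ltW xy)); rewrite vl eqxx.
have [FU [x' [xx' lx' x'b vpos]]] := pe.
move: ll'; rewrite le_eqVlt => /predU1P[ll'|ll'].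
  subst l'.
  have [FUy vposy] : F l <= U y /\ (forall z, l < z -> z <= y -> 0 < v z).
    case: c' => [[ly _]|[FUy [y' [yy' ly' y'b vp]]]|[_ [y' [yy' ly' y'b vn]]]].
    - by move: (le_lt_trans lx xy); rewrite ly ltxx.
    - by split => // z lz zy; rewrite vp// (le_trans zy).
    (* Two excursions of opposite signs cannot start at the same [l]: just after [l], [v] would have
       both signs. *)
    - exfalso; pose z := Num.min x' y'.
      have lz : l < z by rewrite lt_min lx'.
      have := vpos z lz; have := vn z lz; rewrite /= !ge_min !lexx orbT => /(_ isT) + /(_ isT).
      by rewrite oppr_gt0 => /lt_trans h /h; rewrite ltxx.
  have Uxy : U x <= U y.
    have [_ _ h3 _ _] := mc; apply: h3 => //; first exact: le_trans lx.
    by move=> z xz zy; rewrite vposy// (le_lt_trans lx).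
  rewrite !ger0_norm ?subr_ge0//; lra.
have xl' : x < l'.
  rewrite ltNge; apply/negP => l'x.
  by have := nz l' ll' l'x; rewrite vl' eqxx.
have [z [xz zl' UF]] := excursion_catch_up mc vK al lx pe xl' (le_trans l'y (ltW yb)) vl'.
have lz := le_trans lx xz.
have zb := lt_trans (lt_le_trans zl' l'y) yb.
have := FV al lz zb; have := FV (le_trans al lz) (ltW zl') (le_lt_trans l'y yb).
have := ler_norm (F z - F l).
have t1 : `|U y - U x| <= `|U y - F l'| + `|F l' - F z| + (F z - U x).
  have -> : U y - U x = (U y - F l') + (F l' - F z) + (F z - U x) by ring.
  rewrite (le_trans (ler_normD _ _))// lerD ?ler_normD//.
  by rewrite ger0_norm ?subr_ge0.
rewrite [`|U x - F l|]ger0_norm ?subr_ge0//; lra.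
Qed.

End comparison.

(** The bound [Phi x <= M] is where [v b = 0] enters: on a positive excursion [U x <= F z] for some
    [z < b], so V(l) + U(x) - F(l) <= V(z). Negative excursions reduce to positive ones by changing
    signs. *)
Lemma variation_comparison U F v V (M : R) :
    monotone_coupling U F v -> lipschitz_itv K a b v -> v a = 0 -> v b = 0 ->
    (forall x y, a <= x -> x <= y -> y < b -> `|F y - F x| <= V y - V x) ->
    (forall x, a <= x -> x < b -> 0 <= V x <= M) ->
  exists Phi : R -> R, (forall x, a <= x -> x < b -> 0 <= Phi x <= M) /\
    (forall x y, a <= x -> x < y -> y < b -> `|U y - U x| <= Phi y - Phi x).
Proof.
move=> mc vK va vb FV VM.
have mcN := monotone_couplingN mc; have vKN := lipschitz_itvN vK.
have FVN x y : a <= x -> x <= y -> y < b -> `|(\- F) y - (\- F) x| <= V y - V x.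
  by move=> ax xy yb; rewrite /= -opprD normrN; exact: FV.
have normN s t : `|- s - - t| = `|s - t| :> R by rewrite -opprD normrN.
have /boolp.choice[l hl] x : exists l, a <= x -> x < b -> last_contact U F v x l.
  have [ax|xa] := leP a x; last by exists 0.
  have [xb|bx] := ltP x b; last by exists 0.
  by have [l hl] := last_contact_ex mc vK va ax xb; exists l.
exists (fun x => V (l x) + `|U x - F (l x)|); split => [x ax xb|x y ax xy yb].
  have lc := hl x ax xb; have [al lx vl nz c] := lc.
  have lb := le_lt_trans lx xb.
  apply/andP; split; first by rewrite addr_ge0//; have /andP[] := VM _ al lb.
  case: c => [[lxE ->]|pe|pe].
  - by rewrite lxE subrr normr0 addr0; have /andP[] := VM _ ax xb.
  - have [z [xz zb UF]] := excursion_catch_up mc vK al lx pe xb (lexx b) vb.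
    have := FV _ _ al (le_trans lx xz) zb; have /andP[_] := VM _ (le_trans ax xz) zb.
    have := ler_norm (F z - F (l x)).
    by rewrite [`|U x - _|]ger0_norm ?subr_ge0 ?pe.1//; lra.
  - have vbN : (\- v) b = 0 by rewrite /= vb oppr0.
    have [z [xz zb UF]] := excursion_catch_up mcN vKN al lx pe xb (lexx b) vbN.
    have := FV _ _ al (le_trans lx xz) zb; have /andP[_] := VM _ (le_trans ax xz) zb.
    have := ler_norm (- (F z - F (l x))); rewrite normrN.
    have := pe.1; move: UF; rewrite /= !lerN2 => UF FU.
    by rewrite [`|U x - _|]ler0_norm ?subr_le0//; lra.
have xb := lt_trans xy yb; have ay := le_trans ax (ltW xy).
have lcx := hl x ax xb; have lcy := hl y ay yb.
have [al lx vl nz c] := lcx; have [al' l'y vl' nz' _] := lcy.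
case: c => [[lxE UF]|pe|pe].
- rewrite lxE UF subrr normr0 addr0.
  have xl' : x <= l y.
    rewrite leNgt; apply/negP => l'x.
    by have := nz' x l'x (ltW xy); rewrite -lxE vl eqxx.
  have := FV _ _ ax xl' (le_lt_trans l'y yb).
  have : `|U y - U x| <= `|U y - F (l y)| + `|F (l y) - F x|.
    by rewrite -UF; apply: le_trans (ler_normD _ _); rewrite addrA subrK.
  by rewrite UF; lra.
- exact: (last_contact_step_pos FV mc vK lcx pe lcy xy yb).
- have := last_contact_step_pos FVN mcN vKN (last_contactN lcx) pe (last_contactN lcy) xy yb.
  by rewrite /= !normN.
Qed.

End variation_comparison.

(** * From increments to the variation measure *)

Section increments.
Context (R : realType).
Local Notation mR := (measurableTypeR R).
Implicit Types (a b c x y M : R) (nu : {charge set mR -> \bar R}).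

Definition right_continuous_at (g : R -> R) x :=
  forall e : R, 0 < e -> exists2 d, x < d & forall z, x <= z -> z < d -> `|g z - g x| < e.

Lemma right_continuous_atP (g : R -> R) x : right_continuous_at g x -> g @ x^'+ --> g x.
Proof.
move=> gx; apply/cvgrPdist_lt => e e0; have [d xd hd] := gx e e0.
near=> z; rewrite distrC; apply: hd.
  by near: z; exact: nbhs_right_ge.
by near: z; exact: nbhs_right_lt.
Unshelve. all: by end_near. Qed.

Lemma primitive_right_continuous a nu x : right_continuous_at (primitive a nu) x.
Proof.
move=> e e0; have [ax|xa] := leP a x; last first.
  exists a => // z xz za; rewrite !primitive_le ?subrr ?normr0//; exact: ltW.
have x1 : x < x + 1 by rewrite ltrDl.
have [d /andP[xd _] hd] := variation_right nu e0 x1.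
exists d => // z xz zd; apply: le_lt_trans (hd _ xz zd).
exact: le_norm_primitiveB.
Qed.

Lemma lebesgue_stieltjes_measure_ocitv (g : cumulative R R) x y : x <= y ->
  lebesgue_stieltjes_measure g `]x, y]%classic = (g y - g x)%:E.
Proof.
move=> xy; rewrite /lebesgue_stieltjes_measure/= /measure_extension measurable_mu_extE/=; last exact: is_ocitv.
by rewrite wlength_itv_bnd.
Qed.

(** The value G(x+) of a nondecreasing [G]. Stieltjes measures ask for right continuity, which is
    not known of the control function Phi. *)
Definition right_limit (G : R -> R) x := inf [set G y | y in `]x, +oo[%classic].

Section right_limit.
Variable G : R -> R.
Hypothesis ndG : {homo G : x y / x <= y}.

Lemma right_limit_has_inf x : has_inf [set G y | y in `]x, +oo[%classic].
Proof.
split; first by exists (G (x + 1)), (x + 1) => //=; rewrite in_itv/= andbT ltrDl.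
by exists (G x) => _ [y /= + <-]; rewrite in_itv/= andbT => /ltW; exact: ndG.
Qed.

Lemma right_limit_le x y : x < y -> right_limit G x <= G y.
Proof.
move=> xy; apply: ge_inf; first exact: (right_limit_has_inf x).2.
by exists y => //=; rewrite in_itv/= xy.
Qed.

Lemma right_limit_ge x c : (forall y, x < y -> c <= G y) -> c <= right_limit G x.
Proof.
move=> h; apply: lb_le_inf; first exact: (right_limit_has_inf x).1.
by move=> _ [y /= + <-]; rewrite in_itv/= andbT; exact: h.
Qed.

Lemma right_limit_adherent x e : 0 < e -> exists2 y, x < y & G y < right_limit G x + e.
Proof.
move=> e0; have [_ [y /= + <-] Gy] := inf_adherent e0 (right_limit_has_inf x).
by rewrite in_itv/= andbT => xy; exists y.
Qed.

Lemma right_limit_nd : {homo right_limit G : x y / x <= y}.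
Proof.
move=> x y xy; apply: right_limit_ge => z yz; apply: right_limit_le.
exact: le_lt_trans yz.
Qed.

Lemma right_limit_right_continuous x : right_continuous_at (right_limit G) x.
Proof.
move=> e e0; have [y xy Gy] := right_limit_adherent x e0.
exists y => // z xz zy; rewrite ger0_norm ?subr_ge0 ?right_limit_nd//.
by rewrite ltrBlDl (le_lt_trans _ Gy)// right_limit_le.
Qed.

(** The increment bound between [s] slightly after [x] and [t] slightly after [y] passes to the
    limit: [p] is right-continuous, and G(t) - G(s) is almost at most G(y+) - G(x+). Each of the
    three errors is at most e / 3. *)
Lemma right_limit_dominates (p : R -> R) : (forall x, right_continuous_at p x) ->
  (forall x y, x <= y -> `|p y - p x| <= G y - G x) ->
  forall x y, x <= y -> `|p y - p x| <= right_limit G y - right_limit G x.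
Proof.
move=> pr pG x y; rewrite le_eqVlt => /predU1P[->|xy]; first by rewrite !subrr normr0.
apply/ler_addgt0Pr => e e0.
have e30 : 0 < e / 3 by rewrite divr_gt0.
have [y1 yy1 Gy1] := right_limit_adherent y e30.
have [y2 yy2 py2] := pr y _ e30.
have [x2 xx2 px2] := pr x _ e30.
pose s := (x + Num.min x2 y) / 2; pose t := (y + Num.min y1 y2) / 2.
have xm : x < Num.min x2 y by rewrite lt_min xx2.
have ym : y < Num.min y1 y2 by rewrite lt_min yy1.
have xs : x < s by rewrite midf_lt.
have : s < Num.min x2 y by rewrite midf_lt.
rewrite lt_min => /andP[sx2 sy].
have yt : y < t by rewrite midf_lt.
have : t < Num.min y1 y2 by rewrite midf_lt.
rewrite lt_min => /andP[ty1 ty2].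
have := pG s t (ltW (lt_trans sy yt)).
have := right_limit_le xs; have := ndG (ltW ty1).
have := py2 t (ltW yt) ty2; have := px2 s (ltW xs) sx2.
have : `|p y - p x| <= `|p t - p y| + `|p t - p s| + `|p s - p x|.
  have -> : p y - p x = - (p t - p y) + (p t - p s) + (p s - p x) by ring.
  rewrite (le_trans (ler_normD _ _))// lerD2r (le_trans (ler_normD _ _))//.
  by rewrite normrN.
lra.
Qed.

End right_limit.

(** With [p] the primitive of [nu], the increment bound makes (G + p)/2 and (G - p)/2 nondecreasing.
    Their Stieltjes measures have difference [nu], and their sum gives []a, b]] the mass G(b) -
    G(a). *)
Lemma variation_measure_le_nondecreasing a b nu (G : R -> R) : a < b ->
    vanishes_outside a b nu -> {homo G : x y / x <= y} ->
    (forall x, right_continuous_at G x) ->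
    (forall x y, x <= y -> `|primitive a nu y - primitive a nu x| <= G y - G x) ->
  (variation_measure nu `]a, b[%classic <= (G b - G a)%:E)%E.
Proof.
move=> ab nu0 ndG rcG pG.
pose p := primitive a nu.
have half_nd (s : R) : `|s| = 1 -> {homo (fun x => (G x + s * p x) / 2) : x y / x <= y}.
  move=> s1 x y xy; rewrite ler_pM2r ?invr_gt0//.
  have := pG x y xy; have := ler_norm (- (s * (p y - p x))).
  by rewrite normrN normrM s1 mul1r mulrBr -/p; lra.
have half_rc (s : R) : `|s| = 1 -> right_continuous (fun x => (G x + s * p x) / 2).
  move=> s1 x; apply: cvgM; last exact: cvg_cst.
  apply: cvgD; first exact: right_continuous_atP.
  apply: cvgM; first exact: cvg_cst.
  by apply: right_continuous_atP; exact: primitive_right_continuous.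
have n1 : `|1| = 1 :> R by rewrite normr1.
have nN1 : `|-1| = 1 :> R by rewrite normrN1.
pose G1 : cumulative R R := HB.pack (fun x => (G x + 1 * p x) / 2)
  (isCumulative.Build R _ R (fun x => (G x + 1 * p x) / 2) (half_nd _ n1) (half_rc _ n1)).
pose G2 : cumulative R R := HB.pack (fun x => (G x + -1 * p x) / 2)
  (isCumulative.Build R _ R (fun x => (G x + -1 * p x) / 2) (half_nd _ nN1) (half_rc _ nN1)).
pose L1 : {measure set mR -> \bar R} := lebesgue_stieltjes_measure G1.
pose L2 : {measure set mR -> \bar R} := lebesgue_stieltjes_measure G2.
have L1E x y : x <= y -> L1 `]x, y]%classic = (G1 y - G1 x)%:E.
  exact: lebesgue_stieltjes_measure_ocitv.
have L2E x y : x <= y -> L2 `]x, y]%classic = (G2 y - G2 x)%:E.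
  exact: lebesgue_stieltjes_measure_ocitv.
have moc x y : measurable (`]x, y]%classic : set mR) by exact: measurable_itv.
have nuE x y : x <= y -> fine (nu `]x, y]%classic) = p y - p x.
  by move=> xy; rewrite -(vanishes_primitiveB nu0 xy).
have G1E x : G1 x = (G x + 1 * p x) / 2 by [].
have G2E x : G2 x = (G x + -1 * p x) / 2 by [].
pose m1 : {measure set mR -> \bar R} := measure_add (pos_part nu) L2.
pose m2 : {measure set mR -> \bar R} := measure_add (neg_part nu) L1.
have m1E A : (m1 A = pos_part nu A + L2 A)%E by exact: measure_addE.
have m2E A : (m2 A = neg_part nu A + L1 A)%E by exact: measure_addE.
have mE A : measurable A -> m1 A = m2 A.
  apply: measure_eq_ocitv => x y; have [yx|xy] := leP y x.
  - by rewrite set_itv_ge ?measure0// bnd_simp -leNgt.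
  - rewrite m1E m2E; have := nuE x y (ltW xy); rewrite L1E ?L2E ?ltW// G1E G1E G2E G2E charge_jordanE//.
    have := pos_part_fin nu (moc x y); have := neg_part_fin nu (moc x y).
    case: (pos_part nu _) (neg_part nu _) => [q||] [n||]//= _ _ E.
    rewrite -?EFinD; congr EFin; lra.
  - by rewrite set_itv_ge ?measure0// bnd_simp -leNgt.
  - by rewrite m1E L2E ?(ltW xy)// ltey_eq fin_numD pos_part_fin.
have num A : measurable A -> (nu A + L2 A = L1 A)%E.
  move=> mA; have := mE A mA; rewrite m1E m2E charge_jordanE//.
  have := pos_part_fin nu mA; have := neg_part_fin nu mA.
  case: (pos_part nu A) (neg_part nu A) => [q||] [n||]//= _ _.
  case: (L1 A) (L2 A) => [r1||] [r2||]//= [E].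
  by rewrite -?EFinD; congr EFin; lra.
have mab : measurable (`]a, b[%classic : set mR) by exact: measurable_itv.
apply: (@le_trans _ _ (L1 `]a, b[%classic + L2 `]a, b[%classic)%E).
  exact: variation_measure_le num _ mab.
apply: (@le_trans _ _ (L1 `]a, b]%classic + L2 `]a, b]%classic)%E).
  by apply: leeD; apply: le_measure; rewrite ?inE//; exact: subset_itv_oo_oc.
rewrite (L1E _ _ (ltW ab)) (L2E _ _ (ltW ab)) -EFinD lee_fin G1E G1E G2E G2E; lra.
Qed.

End increments.

Section total_variation_bound.
Context (R : realType).
Local Notation leb := (@lebesgue_measure R).
Local Notation mR := (measurableTypeR R).
Implicit Types (a b M : R) (nu : {charge set mR -> \bar R}).

Lemma variation_measure_le_increments a b nu (Phi : R -> R) M : a < b ->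
    vanishes_outside a b nu -> (forall x, a <= x -> x < b -> 0 <= Phi x <= M) ->
    (forall x y, a <= x -> x < y -> y < b ->
      `|primitive a nu y - primitive a nu x| <= Phi y - Phi x) ->
  (variation_measure nu `]a, b[%classic <= M%:E)%E.
Proof.
move=> ab nu0 PhiM Phi_p; pose p := primitive a nu.
(* [Phi] is controlled only on [[a, b[]. The jump up to [M] at [b] absorbs its unknown left limit
   there. *)
pose G x := if x < a then Phi a else if x < b then Phi x else M.
have /andP[Phia0 PhiaM] := PhiM a (lexx a) ab.
have pa x : x <= a -> p x = 0 by exact: primitive_le.
have pPhi x y : a <= x -> x <= y -> y < b -> `|p y - p x| <= Phi y - Phi x.
  move=> ax; rewrite le_eqVlt => /predU1P[->|xy] yb; first by rewrite !subrr normr0.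
  exact: Phi_p.
(* [p] has no jump at [b], so this is the limit of the bound at [y] as [y] increases to [b], with
   [Phi y <= M]. *)
have pb x : a <= x -> x < b -> `|p b - p x| <= M - Phi x.
  move=> ax xb; apply/ler_addgt0Pr => e e0.
  have [d /andP[ad db] hd] := variation_left ab nu0 e0.
  pose y := (Num.max d x + b) / 2.
  have mb : Num.max d x < b by rewrite gt_max db.
  have yb : y < b by rewrite midf_lt.
  have : Num.max d x < y by rewrite midf_lt.
  rewrite gt_max => /andP[dy xy].
  have ay : a <= y by rewrite (le_trans ax) ?ltW.
  have := hd y dy (ltW yb); have := le_norm_primitiveB nu ay (ltW yb); rewrite -/p.
  have := pPhi x y ax (ltW xy) yb; have /andP[_] := PhiM y ay yb.
  have := ler_normD (p b - p y) (p y - p x); rewrite addrA subrK; lra.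
have pG x y : x <= y -> `|p y - p x| <= G y - G x.
  move=> xy; rewrite /G.
  have [xa|ax] := ltP x a; have [ya|ay] := ltP y a.
  - by rewrite !pa ?subrr ?normr0// ltW.
  - rewrite (pa x) ?(ltW xa)// -(pa a (lexx a)); have [yb|by_] := ltP y b; first exact: pPhi.
    by rewrite /p (primitive_ge_b ab nu0 by_) pb.
  - by move: (le_lt_trans xy ya); rewrite ltNge ax.
  - have [xb|bx] := ltP x b; have [yb|by_] := ltP y b.
    + exact: pPhi.
    + by rewrite /p (primitive_ge_b ab nu0 by_) pb.
    + by move: (le_lt_trans xy yb); rewrite ltNge bx.
    + by rewrite /p !(primitive_ge_b ab nu0 _)// !subrr normr0.
have ndG : {homo G : x y / x <= y}.
  by move=> x y xy; rewrite -subr_ge0; apply: le_trans (pG x y xy).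
apply: (le_trans (variation_measure_le_nondecreasing (G := right_limit G) ab nu0 _ _ _)).
- exact: right_limit_nd.
- exact: right_limit_right_continuous.
- apply: right_limit_dominates => // x; exact: primitive_right_continuous.
rewrite lee_fin; have : right_limit G b <= M.
  have := right_limit_le ndG (_ : b < b + 1); rewrite ltrDl => /(_ ltr01).
  by rewrite /G !ifN// -leNgt ?lerDl// (le_trans (ltW ab))// lerDl.
have : 0 <= right_limit G a.
  apply: (right_limit_ge ndG) => y ay; apply: le_trans (ndG _ _ (ltW ay)).
  by rewrite /G ltxx ab.
lra.
Qed.

End total_variation_bound.

(** * Optimality conditions and conclusion *)

Lemma crestr0_chargeE d (T : measurableType d) (R : realType)
    (nu : {charge set T -> \bar R}) (S A : set T) (mS : measurable S) :
  measurable A -> (crestr0 nu mS : {charge set T -> \bar R}) A = nu (A `&` S).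
Proof. by move=> mA; rewrite -[LHS]/(crestr0 nu mS A) /crestr0 mem_set. Qed.

Section optimality.
Context (R : realType).
Local Notation leb := (@lebesgue_measure R).
Local Notation mR := (measurableTypeR R).
Variables (a b cu cf : R) (alpha f u : R -> R).
Hypothesis ab : a < b.
Hypothesis ca : {within `[a, b], continuous alpha}.
Hypothesis a0 : forall x : R, a <= x <= b -> 0 <= alpha x.
Hypothesis BVf : BV a b f.
Hypothesis umin : is_argmin_BV a b (weighted_TV_energy a b alpha f) u.
Let nu := distr_derivative a b u.
Let mu := distr_derivative a b f.
Let U x := cu + primitive a nu x.
Let F x := cf + primitive a mu x.
Hypothesis fF : {ae leb, forall x, `]a, b[%classic x -> f x = F x}.
Hypothesis uU : {ae leb, forall x, `]a, b[%classic x -> u x = U x}.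
Let h x := U x - F x.
Let v := potential b h.
Let D : set mR := `]a, b[%classic.
Let mD : measurable D. Proof. exact: measurable_itv. Qed.
Let KF := `|cf| + fine (variation_measure mu setT).
Let KU := `|cu| + fine (variation_measure nu setT).

Let mf : measurable_fun D f.
Proof. by apply/measurable_EFinP; exact: (measurable_int leb BVf.1). Qed.

Let mU : measurable_fun D U.
Proof. by apply: measurable_funD => //; exact: measurable_primitive. Qed.

Let mF : measurable_fun D F.
Proof. by apply: measurable_funD => //; exact: measurable_primitive. Qed.

Let mh : measurable_fun D h.
Proof. exact: measurable_funB. Qed.

Let FK x : `|F x| <= KF.
Proof. by rewrite (le_trans (ler_normD _ _))// lerD2l primitive_bounded. Qed.

Let UK x : `|U x| <= KU.
Proof. by rewrite (le_trans (ler_normD _ _))// lerD2l primitive_bounded. Qed.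

Let hK x : `|h x| <= KU + KF.
Proof. by rewrite (le_trans (ler_normB _ _))// lerD. Qed.

Let nu0 : vanishes_outside a b nu.
Proof. by have [] := distr_derivativeP umin.1. Qed.

Let ih : leb.-integrable `]a, b[ (EFin \o h).
Proof. exact: (integrable_itv_bounded (M := KU + KF)). Qed.

Let fv := first_variation ab ca a0 umin mf mF FK fF uU.

(** For empty [S] the competitors are [u] plus constants; [k = 1] and [k = -1] together force
    [u - f] to have mean zero. *)
Let v_start : v a = 0.
Proof.
have p0 x : primitive a (crestr0 nu (@measurable0 _ mR)) x = 0.
  by rewrite /primitive crestr0_chargeE ?setI0 ?charge0//; exact: measurable_itv.
have E k : \int[leb]_(x in `]a, b[) (h x * (k - primitive a (crestr0 nu (@measurable0 _ mR)) x)) =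
    k * \int[leb]_(x in `]a, b[) h x.
  by rewrite -RintegralZl//; apply: eq_Rintegral => x _; rewrite p0 subr0 mulrC.
have := fv 1 (@measurable0 _ mR); have := fv (-1) (@measurable0 _ mR).
rewrite !E mul1r mulN1r => h1 h2.
rewrite /v /potential -Rintegral_itv_obnd_cbnd//; lra.
Qed.

Let S1 : set mR := D `&` [set x | 0 < v x].
Let S2 : set mR := D `&` [set x | v x < 0].

Let mv : measurable_fun D v.
Proof. exact: (measurable_potential mh hK). Qed.

Let mS1 : measurable S1.
Proof.
have -> : S1 = D `&` v @^-1` `]0, +oo[%classic.
  by apply/seteqP; split => x [Dx]; rewrite /= in_itv/= andbT.
exact: mv.
Qed.

Let mS2 : measurable S2.
Proof.
have -> : S2 = D `&` v @^-1` `]-oo, 0[%classic.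
  by apply/seteqP; split => x [Dx]; rewrite /= in_itv.
exact: mv.
Qed.

(* Removing from [Du] its negative part on [v > 0] does not increase the weighted
   total variation, and lowers the fidelity term unless that part is zero. *)
Lemma neg_part_null : neg_part nu S1 = 0%E.
Proof.
apply: (excursion_null (a := a) (b := b) (h := h) (K := KU + KF) (mS := mS1) (neg_partT_lty nu)) => //.
- by move=> x [].
- by move=> x [].
(* On this set [nu] is minus its negative part, so with [k = 0] the direction [k - w] is the
   primitive of [neg_part nu] restricted to [S1]. *)
have mS : measurable (hahn_neg_set nu `&` S1).
  by apply: measurableI => //; exact: measurable_hahn_neg_set.
apply: (le_trans (fv 0 mS)); rewrite le_eqVlt; apply/orP; left; apply/eqP.
apply: eq_Rintegral => x _; congr (_ * _); rewrite sub0r /primitive.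
have moc : measurable (`]a, x]%classic : set mR) by exact: measurable_itv.
rewrite crestr0_chargeE// /mrestr neg_partE; last exact: measurableI.
rewrite [hahn_neg_set nu `&` _]setIC setIA fineN//.
Qed.

(** The mirror image of [neg_part_null]: passing to [- h] changes the sign of the potential, which
    becomes positive on [S2]. *)
Lemma pos_part_null : pos_part nu S2 = 0%E.
Proof.
apply: (excursion_null (a := a) (b := b) (h := \- h) (K := KU + KF) (mS := mS2) (pos_partT_lty nu)) => //.
- exact: measurableT_comp.
- by move=> x; rewrite normrN.
- by move=> x [].
- move=> x [Dx vx].
  rewrite potentialN ?oppr_gt0//.
  apply: integrableS ih => //.
  move: Dx; rewrite /D/= in_itv/= => /andP[ax _] z /=; rewrite !in_itv/= => /andP[xz ->].
  by rewrite (lt_le_trans ax xz).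
have mS : measurable (hahn_pos_set nu `&` S2).
  by apply: measurableI => //; exact: measurable_hahn_pos_set.
apply: (le_trans (fv 0 mS)); rewrite le_eqVlt; apply/orP; left; apply/eqP.
apply: eq_Rintegral => x _; rewrite /= mulNr -mulrN; congr (_ * _); rewrite sub0r /primitive.
have moc : measurable (`]a, x]%classic : set mR) by exact: measurable_itv.
rewrite crestr0_chargeE// /mrestr pos_partE; last exact: measurableI.
by rewrite [hahn_pos_set nu `&` _]setIC setIA.
Qed.

Let primitive_mono (m : {measure set mR -> \bar R}) (S : set mR) x y : measurable S ->
  m S = 0%E -> `]x, y]%classic `<=` S -> m `]x, y]%classic = 0%E.
Proof.
move=> mS mS0 xyS; apply/eqP; rewrite -measure_le0 -mS0 le_measure ?inE//.
Qed.

Let UB x y : a <= x -> x <= y -> U y - U x =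
  fine (pos_part nu `]x, y]%classic) - fine (neg_part nu `]x, y]%classic).
Proof.
move=> ax xy; rewrite /U opprD addrACA subrr add0r primitiveB//.
have moc : measurable (`]x, y]%classic : set mR) by exact: measurable_itv.
by rewrite charge_jordanE// fineB// ?pos_part_fin ?neg_part_fin.
Qed.

Lemma optimality_coupling : monotone_coupling a b U F v.
Proof.
split.
- by move=> c x y ax xy yb hc; exact: (potential_ge mh hK).
- by move=> c x y ax xy yb hc; exact: (potential_le mh hK).
- move=> x y ax xy yb vpos; rewrite -subr_ge0 (UB ax (ltW xy)).
  have -> : neg_part nu `]x, y]%classic = 0%E.
    apply: (primitive_mono mS1 neg_part_null) => z /=.
    rewrite in_itv/= => /andP[xz zy]; split; last exact: vpos.
    by rewrite /D/= in_itv/= (le_lt_trans ax xz) (le_lt_trans zy yb).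
  by rewrite fine0 subr0 fine_ge0.
- move=> x y ax xy yb vneg; rewrite -subr_le0 (UB ax (ltW xy)).
  have -> : pos_part nu `]x, y]%classic = 0%E.
    apply: (primitive_mono mS2 pos_part_null) => z /=.
    rewrite in_itv/= => /andP[xz zy]; split; last exact: vneg.
    by rewrite /D/= in_itv/= (le_lt_trans ax xz) (le_lt_trans zy yb).
  by rewrite fine0 sub0r oppr_le0 fine_ge0.
- move=> x e ax xb e0; have e20 : 0 < e / 2 by rewrite divr_gt0.
  have [d1 xd1 h1] := @primitive_right_continuous _ a nu x _ e20.
  have [d2 xd2 h2] := @primitive_right_continuous _ a mu x _ e20.
  exists ((x + Num.min b (Num.min d1 d2)) / 2).
    have xm : x < Num.min b (Num.min d1 d2) by rewrite !lt_min xb xd1.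
    by rewrite midf_lt//= (lt_le_trans (midf_lt xm).2)// ge_min lexx.
  move=> z xz zd.
  have xm : x < Num.min b (Num.min d1 d2) by rewrite !lt_min xb xd1.
  have := lt_trans zd (midf_lt xm).2; rewrite !lt_min => /and3P[_ zd1 zd2].
  have := h1 z xz zd1; have := h2 z xz zd2.
  have -> : U z - F z - (U x - F x) = (primitive a nu z - primitive a nu x) -
      (primitive a mu z - primitive a mu x) by rewrite /U /F; ring.
  by have := ler_normB (primitive a nu z - primitive a nu x)
    (primitive a mu z - primitive a mu x); lra.
Qed.

Lemma optimality_lipschitz : lipschitz_itv (KU + KF) a b v.
Proof. by move=> x y ax xy yb; exact: (potential_lipschitz mh hK). Qed.

Lemma optimality_variation_le :
  (variation_measure nu `]a, b[%classic <= variation_measure mu `]a, b[%classic)%E.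
Proof.
pose V x := fine (variation_measure mu `]a, x]%classic).
have FV x y : a <= x -> x <= y -> y < b -> `|F y - F x| <= V y - V x.
  move=> ax xy yb; rewrite /F opprD addrACA subrr add0r.
  rewrite (le_trans (le_norm_primitiveB mu ax xy))// lerBrDl /V.
  have moc s t : measurable (`]s, t]%classic : set mR) by exact: measurable_itv.
  rewrite -fineD ?variation_measure_fin// -measureU//.
    rewrite fine_le ?variation_measure_fin//; first exact: measurableU.
    rewrite le_measure ?inE//; first exact: measurableU.
    move=> z /=; rewrite !in_itv/= => -[/andP[-> zx]|/andP[xz ->]].
      by rewrite (le_trans zx xy).
    by rewrite (le_lt_trans ax xz).
  apply/seteqP; split => // z /=; rewrite !in_itv/= => -[/andP[_ zx] /andP[xz _]].
  by move: xz; rewrite ltNge zx.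
have VM x : a <= x -> x < b -> 0 <= V x <= fine (variation_measure mu `]a, b[%classic).
  move=> ax xb; rewrite fine_ge0//= fine_le ?variation_measure_fin//; try exact: measurable_itv.
  rewrite le_measure ?inE//; try exact: measurable_itv.
  by move=> z /=; rewrite !in_itv/= => /andP[-> /le_lt_trans]; apply.
have [Phi [PhiM PhiU]] := variation_comparison optimality_coupling optimality_lipschitz
  v_start (potential_end b h) FV VM.
rewrite -[leRHS]fineK ?variation_measure_fin//.
apply: (variation_measure_le_increments ab nu0 PhiM) => x y ax xy yb.
by have := PhiU x y ax xy yb; rewrite /U opprD addrACA subrr add0r.
Qed.

End optimality.

Theorem theorem5p4 (R : realType) (a b : R) (alpha f u : R -> R)
    (hab : a < b)
    (halpha_cont : {within `[a, b], continuous alpha})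
    (halpha_ge0 : forall x : R, a <= x <= b -> 0 <= alpha x)
    (hf : BV a b f)
    (hu : is_argmin_BV a b (weighted_TV_energy a b alpha f) u) :
  (total_var_measure a b u `]a, b[ <= total_var_measure a b f `]a, b[)%E.
Proof.
(* The representatives are primitives of the very charges that define [total_var_measure], so the
   bound between variation measures is already the claim. *)
have [cf fF] := BV_primitiveP hab hf.1 (distr_derivativeP hf).
have [cu uU] := BV_primitiveP hab hu.1.1 (distr_derivativeP hu.1).
exact: optimality_variation_le fF uU.
Qed.
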